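(* Let $A$ be a unitary ring. A recollement of $\mathrm{Mod}\text{-}A$ is equivalent to a recollement in which the categories involved are module categories if and only if it is equivalent to a recollement induced by an idempotent element of a ring $S$, Morita equivalent to $A$. If, furthermore, $A$ is semiprimary, then any recollement of $\mathrm{Mod}\text{-}A$ is equivalent to a recollement induced by an idempotent element of $A$.
   Context: All rings are unitary; $\mathrm{Mod}\text{-}A$ denotes the category of right $A$-modules. A module category is a category of the form $\mathrm{Mod}\text{-}R$ for a unitary ring $R$. $\operatorname{Im}F$ denotes the essential image of a functor $F$ and $\operatorname{Ker}F$ the full subcategory of objects sent to zero. A recollement $\mathsf{R}(\mathscr B,\mathscr A,\mathscr C)$ of an abelian category $\mathscr A$ by abelian categories $\mathscr B$ and $\mathscr C$ consists of additive functors $i_*\colon\mathscr B\to\mathscr A$, $i^*,i^!\colon\mathscr A\to\mathscr B$, $j^*\colon\mathscr A\to\mathscr C$, $j_!,j_*\colon\mathscr C\to\mathscr A$ such that: (1) $(j_!,j^*,j_* )$ and $(i^*,i_*,i^!)$ are adjoint triples (each functor is left adjoint to the next); (2) $i_*$, $j_!$ and $j_*$ are fully faithful; (3) $\operatorname{Im} i_*=\operatorname{Ker} j^*$. Two recollements $\mathsf{R}(\mathscr B,\mathscr A,\mathscr C)$ and $\mathsf{R}(\mathscr B',\mathscr A',\mathscr C')$ are equivalent if there are equivalences $\Phi\colon\mathscr A\to\mathscr A'$ and $\Theta\colon\mathscr C\to\mathscr C'$ such that $\Theta j^*$ and $j^{*\prime}\Phi$ are naturally equivalent, where $j^{*\prime}\colon\mathscr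 A'\to\mathscr C'$ is the corresponding functor of the second recollement. For a ring $S$ and an idempotent element $e\in S$, the recollement induced by $e$ is $\mathsf{R}(\mathrm{Mod}\text{-}S/SeS,\mathrm{Mod}\text{-}S,\mathrm{Mod}\text{-}eSe)$ with $i_*$ the natural inclusion, $i^*=-\otimes_S S/SeS$, $i^!=\operatorname{Hom}_S(S/SeS,-)$, $j^*=\operatorname{Hom}_S(eS,-)$, $j_!=-\otimes_{eSe}eS$, $j_*=\operatorname{Hom}_{eSe}(Se,-)$. A ring $A$ is semiprimary if its Jacobson radical $J(A)$ is nilpotent and $A/J(A)$ is semisimple. *)

(* Defs.v *)
From HB Require Import structures.
From mathcomp Require Import all_boot all_algebra.
From mathcomp Require Import boolp.
From mathcomp.multinomials Require Import freeg.

Set Implicit Arguments.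
Unset Strict Implicit.
Unset Printing Implicit Defensive.

Import GRing.Theory.
Local Open Scope ring_scope.

Record preadditive := Preadditive {
  ob :> Type;
  mor : ob -> ob -> zmodType;
  idm : forall X, mor X X;
  comp : forall X Y Z, mor Y Z -> mor X Y -> mor X Z;
  comp_idl : forall X Y (f : mor X Y), comp (idm Y) f = f;
  comp_idr : forall X Y (f : mor X Y), comp f (idm X) = f;
  comp_assoc : forall W X Y Z (h : mor Y Z) (g : mor X Y) (f : mor W X),
    comp h (comp g f) = comp (comp h g) f;
  compDl : forall X Y Z (g g' : mor Y Z) (f : mor X Y),
    comp (g + g') f = comp g f + comp g' f;
  compDr : forall X Y Z (g : mor Y Z) (f f' : mor X Y),
    comp g (f + f') = comp g f + comp g f'
}.

Arguments mor {C} X Y : rename.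
Arguments idm {C} X : rename.
Arguments comp {C X Y Z} g f : rename.
Notation "g \oc f" := (comp g f) (at level 40, left associativity).

Definition is_iso (C : preadditive) (X Y : C) (f : mor X Y) : Prop :=
  exists g : mor Y X, g \oc f = idm X /\ f \oc g = idm Y.

Definition isomorphic (C : preadditive) (X Y : C) : Prop :=
  exists f : mor X Y, is_iso f.

Definition is_zero_object (C : preadditive) (Z : C) : Prop :=
  (forall (X : C) (f g : mor X Z), f = g) /\
  (forall (X : C) (f g : mor Z X), f = g).

Definition is_biproduct (C : preadditive) (X Y P : C) : Prop :=
  exists (i1 : mor X P) (i2 : mor Y P) (p1 : mor P X) (p2 : mor P Y),
    [/\ p1 \oc i1 = idm X, p2 \oc i2 = idm Y, p1 \oc i2 = 0, p2 \oc i1 = 0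
      & i1 \oc p1 + i2 \oc p2 = idm P].

Definition mono (C : preadditive) (X Y : C) (f : mor X Y) : Prop :=
  forall (W : C) (g h : mor W X), f \oc g = f \oc h -> g = h.

Definition epi (C : preadditive) (X Y : C) (f : mor X Y) : Prop :=
  forall (Z : C) (g h : mor Y Z), g \oc f = h \oc f -> g = h.

Definition is_kernel (C : preadditive) (K X Y : C)
    (k : mor K X) (f : mor X Y) : Prop :=
  f \oc k = 0 /\
  forall (W : C) (g : mor W X), f \oc g = 0 -> exists! u : mor W K, k \oc u = g.

Definition is_cokernel (C : preadditive) (X Y Q : C)
    (q : mor Y Q) (f : mor X Y) : Prop :=
  q \oc f = 0 /\
  forall (Z : C) (g : mor Y Z), g \oc f = 0 -> exists! u : mor Q Z, u \oc q = g.

Record is_abelian (C : preadditive) : Prop := Abelian {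
  ab_zero : exists Z : C, is_zero_object Z;
  ab_biproduct : forall X Y : C, exists P : C, is_biproduct X Y P;
  ab_kernel : forall (X Y : C) (f : mor X Y),
    exists (K : C) (k : mor K X), is_kernel k f;
  ab_cokernel : forall (X Y : C) (f : mor X Y),
    exists (Q : C) (q : mor Y Q), is_cokernel q f;
  ab_mono : forall (X Y : C) (f : mor X Y), mono f ->
    exists (Z : C) (g : mor Y Z), is_kernel f g;
  ab_epi : forall (X Y : C) (f : mor X Y), epi f ->
    exists (W : C) (g : mor W X), is_cokernel f g
}.

Record functor (C D : preadditive) := Functor {
  fob :> C -> D;
  fhom : forall X Y : C, mor X Y -> mor (fob X) (fob Y);
  fhom_id : forall X : C, fhom (idm X) = idm (fob X);
  fhom_comp : forall (X Y Z : C) (g : mor Y Z) (f : mor X Y),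
    fhom (g \oc f) = fhom g \oc fhom f
}.

Arguments fhom {C D} F {X Y} f : rename.

Definition additive_functor (C D : preadditive) (F : functor C D) : Prop :=
  forall (X Y : C) (f g : mor X Y), fhom F (f + g) = fhom F f + fhom F g.

Definition fully_faithful (C D : preadditive) (F : functor C D) : Prop :=
  forall X Y : C, bijective (fun f : mor X Y => fhom F f).

Definition ess_im (C D : preadditive) (F : functor C D) (Y : D) : Prop :=
  exists X : C, isomorphic (F X) Y.

Definition in_ker (C D : preadditive) (F : functor C D) (X : C) : Prop :=
  is_zero_object (F X).

Definition adjoint (C D : preadditive) (F : functor C D) (G : functor D C) :
    Prop :=
  exists phi : forall (X : C) (Y : D), mor (F X) Y -> mor X (G Y),
    (forall X Y, bijective (phi X Y)) /\
    (forall (X X' : C) (Y Y' : D) (u : mor X' X) (v : mor Y Y')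
            (f : mor (F X) Y),
       phi X' Y' (v \oc f \oc fhom F u) = fhom G v \oc phi X Y f \oc u).

Definition nat_iso (C D : preadditive) (F G : functor C D) : Prop :=
  exists t : forall X : C, mor (F X) (G X),
    (forall (X Y : C) (f : mor X Y), t Y \oc fhom F f = fhom G f \oc t X) /\
    (forall X, is_iso (t X)).

Definition fid (C : preadditive) : functor C C :=
  @Functor C C (fun X => X) (fun X Y f => f)
    (fun X => erefl) (fun X Y Z g f => erefl).

Lemma fcomp_id (C D E : preadditive) (G : functor D E) (F : functor C D)
  (X : C) : fhom G (fhom F (idm X)) = idm (G (F X)).
Proof. by rewrite !fhom_id. Qed.

Lemma fcomp_comp (C D E : preadditive) (G : functor D E) (F : functor C D)
  (X Y Z : C) (g : mor Y Z) (f : mor X Y) :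
  fhom G (fhom F (g \oc f)) = fhom G (fhom F g) \oc fhom G (fhom F f).
Proof. by rewrite !fhom_comp. Qed.

Definition fcomp (C D E : preadditive) (G : functor D E)
    (F : functor C D) : functor C E :=
  @Functor C E (fun X => G (F X)) (fun X Y f => fhom G (fhom F f))
    (fcomp_id G F) (fcomp_comp G F).

Definition is_equivalence (C D : preadditive) (F : functor C D) : Prop :=
  exists G : functor D C, nat_iso (fcomp G F) (fid C) /\
                          nat_iso (fcomp F G) (fid D).

Record recollement_functors (B A C : preadditive) := RecollementFunctors {
  i_lower_star : functor B A;
  i_upper_star : functor A B;
  i_upper_shriek : functor A B;
  j_upper_star : functor A C;
  j_lower_shriek : functor C A;
  j_lower_star : functor C A
}.

Record recollement (B A C : preadditive) := Recollement {
  rec_functors :> recollement_functors B A C;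
  rec_abelian : [/\ is_abelian B, is_abelian A & is_abelian C];
  rec_additive_i : [/\ additive_functor (i_lower_star rec_functors),
    additive_functor (i_upper_star rec_functors)
    & additive_functor (i_upper_shriek rec_functors)];
  rec_additive_j : [/\ additive_functor (j_upper_star rec_functors),
    additive_functor (j_lower_shriek rec_functors)
    & additive_functor (j_lower_star rec_functors)];
  rec_adjoint_j :
    adjoint (j_lower_shriek rec_functors) (j_upper_star rec_functors) /\
    adjoint (j_upper_star rec_functors) (j_lower_star rec_functors);
  rec_adjoint_i :
    adjoint (i_upper_star rec_functors) (i_lower_star rec_functors) /\
    adjoint (i_lower_star rec_functors) (i_upper_shriek rec_functors);
  rec_ff : [/\ fully_faithful (i_lower_star rec_functors),
    fully_faithful (j_lower_shriek rec_functors)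
    & fully_faithful (j_lower_star rec_functors)];
  rec_exact : forall X : A,
    ess_im (i_lower_star rec_functors) X <->
    in_ker (j_upper_star rec_functors) X
}.

Definition recollement_equiv (B A C B' A' C' : preadditive)
    (R : recollement B A C) (R' : recollement B' A' C') : Prop :=
  exists (Phi : functor A A') (Theta : functor C C'),
    [/\ is_equivalence Phi, is_equivalence Theta
      & nat_iso (fcomp Theta (j_upper_star R)) (fcomp (j_upper_star R') Phi)].

(* A right R-module is a left module over the converse ring R^c: the product
   x r is written (r : R^c) *: x. Rings are pzRingType, so that the zero ring
   is included (S/SeS and eSe may vanish). *)
Notation rmod R := (lmodType R^c).

Definition ract (R : pzRingType) (M : rmod R) (x : M) (r : R) : M :=
  (r : R^c) *: x.

Lemma linear_ext (R : pzRingType) (U V : lmodType R) (f g : {linear U -> V}) :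
  f =1 g -> f = g.
Proof.
case: f g => [f cf] [g cg] /= /funext fg; rewrite {}fg in cf *.
congr GRing.Linear.Pack.
case: cf cg => [[a1] [a2]] [[b1] [b2]].
by rewrite (Prop_irrelevance a1 b1) (Prop_irrelevance a2 b2).
Qed.

HB.instance Definition _ (R : pzRingType) (U V : lmodType R) :=
  gen_eqMixin {linear U -> V}.
HB.instance Definition _ (R : pzRingType) (U V : lmodType R) :=
  gen_choiceMixin {linear U -> V}.

Definition lin_zero (R : pzRingType) (U V : lmodType R) : {linear U -> V} :=
  (\0 : U -> V).
Definition lin_opp (R : pzRingType) (U V : lmodType R) (f : {linear U -> V}) :
  {linear U -> V} := (\- f).
Definition lin_add (R : pzRingType) (U V : lmodType R)
  (f g : {linear U -> V}) : {linear U -> V} := (f \+ g).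

Lemma lin_addA (R : pzRingType) (U V : lmodType R) :
  associative (@lin_add R U V).
Proof. by move=> f g h; apply: linear_ext => x /=; rewrite addrA. Qed.
Lemma lin_addC (R : pzRingType) (U V : lmodType R) :
  commutative (@lin_add R U V).
Proof. by move=> f g; apply: linear_ext => x /=; rewrite addrC. Qed.
Lemma lin_add0 (R : pzRingType) (U V : lmodType R) :
  left_id (lin_zero U V) (@lin_add R U V).
Proof. by move=> f; apply: linear_ext => x /=; rewrite add0r. Qed.
Lemma lin_addN (R : pzRingType) (U V : lmodType R) :
  left_inverse (lin_zero U V) (@lin_opp R U V) (@lin_add R U V).
Proof. by move=> f; apply: linear_ext => x /=; rewrite addNr. Qed.

HB.instance Definition _ (R : pzRingType) (U V : lmodType R) :=
  GRing.isZmodule.Build {linear U -> V}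
    (@lin_addA R U V) (@lin_addC R U V) (@lin_add0 R U V) (@lin_addN R U V).

Definition lin_id (R : pzRingType) (U : lmodType R) : {linear U -> U} := idfun.
Definition lin_comp (R : pzRingType) (U V W : lmodType R)
  (g : {linear V -> W}) (f : {linear U -> V}) : {linear U -> W} := g \o f.

Lemma lin_comp_idl (R : pzRingType) (U V : lmodType R) (f : {linear U -> V}) :
  lin_comp (lin_id V) f = f.
Proof. exact: linear_ext. Qed.
Lemma lin_comp_idr (R : pzRingType) (U V : lmodType R) (f : {linear U -> V}) :
  lin_comp f (lin_id U) = f.
Proof. exact: linear_ext. Qed.
Lemma lin_compA (R : pzRingType) (T U V W : lmodType R) (h : {linear V -> W})
    (g : {linear U -> V}) (f : {linear T -> U}) :
  lin_comp h (lin_comp g f) = lin_comp (lin_comp h g) f.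
Proof. exact: linear_ext. Qed.
Lemma lin_compDl (R : pzRingType) (U V W : lmodType R)
    (g g' : {linear V -> W}) (f : {linear U -> V}) :
  lin_comp (g + g') f = lin_comp g f + lin_comp g' f.
Proof. exact: linear_ext. Qed.
Lemma lin_compDr (R : pzRingType) (U V W : lmodType R)
    (g : {linear V -> W}) (f f' : {linear U -> V}) :
  lin_comp g (f + f') = lin_comp g f + lin_comp g f'.
Proof. by apply: linear_ext => x; rewrite /= linearD. Qed.

Definition Mod (R : pzRingType) : preadditive :=
  @Preadditive (rmod R) (fun M N => {linear M -> N} : zmodType)
    (@lin_id R^c) (@lin_comp R^c) (@lin_comp_idl R^c) (@lin_comp_idr R^c)
    (@lin_compA R^c) (@lin_compDl R^c) (@lin_compDr R^c).

Definition morita_equivalent (R S : pzRingType) : Prop :=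
  exists F : functor (Mod R) (Mod S), is_equivalence F.

Definition restr (R Q : pzRingType) (h : {rmorphism R -> Q}) (M : rmod Q) :
  Type := M.

HB.instance Definition _ (R Q : pzRingType) (h : {rmorphism R -> Q})
  (M : rmod Q) := GRing.Zmodule.on (restr h M).

Definition restr_scale (R Q : pzRingType) (h : {rmorphism R -> Q})
  (M : rmod Q) (r : R^c) (x : restr h M) : restr h M := ract (x : M) (h r).

Lemma restr_scaleA (R Q : pzRingType) (h : {rmorphism R -> Q}) (M : rmod Q)
    (a b : R^c) (x : restr h M) :
  restr_scale a (restr_scale b x) = restr_scale (a * b) x.
Proof.
rewrite /restr_scale /ract scalerA; congr (_ *: _).
exact: (esym (rmorphM h b a)).
Qed.
Lemma restr_scale1 (R Q : pzRingType) (h : {rmorphism R -> Q}) (M : rmod Q) :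
  left_id 1 (@restr_scale R Q h M).
Proof. by move=> x; rewrite /restr_scale /ract rmorph1 scale1r. Qed.
Lemma restr_scaleDr (R Q : pzRingType) (h : {rmorphism R -> Q}) (M : rmod Q) :
  right_distributive (@restr_scale R Q h M) +%R.
Proof. by move=> a x y; rewrite /restr_scale /ract scalerDr. Qed.
Lemma restr_scaleDl (R Q : pzRingType) (h : {rmorphism R -> Q}) (M : rmod Q)
    (x : restr h M) :
  {morph (@restr_scale R Q h M)^~ x : a b / a + b}.
Proof. by move=> a b; rewrite /restr_scale /ract rmorphD scalerDl. Qed.

HB.instance Definition _ (R Q : pzRingType) (h : {rmorphism R -> Q})
    (M : rmod Q) :=
  GRing.Zmodule_isLmodule.Build R^c (restr h M) (@restr_scaleA R Q h M)
    (@restr_scale1 R Q h M) (@restr_scaleDr R Q h M) (@restr_scaleDl R Q h M).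

Definition restr_fun (R Q : pzRingType) (h : {rmorphism R -> Q}) (M N : rmod Q)
  (f : {linear M -> N}) (x : restr h M) : restr h N := f x.

Lemma restr_fun_linear (R Q : pzRingType) (h : {rmorphism R -> Q})
    (M N : rmod Q) (f : {linear M -> N}) : linear (@restr_fun R Q h M N f).
Proof. by move=> a x y; rewrite /restr_fun linearP. Qed.

HB.instance Definition _ (R Q : pzRingType) (h : {rmorphism R -> Q})
    (M N : rmod Q) (f : {linear M -> N}) :=
  GRing.isLinear.Build R^c (restr h M) (restr h N) *:%R (@restr_fun R Q h M N f)
    (restr_fun_linear f).

Definition restr_hom (R Q : pzRingType) (h : {rmorphism R -> Q})
  (M N : Mod Q) (f : mor M N) : @mor (Mod R) (restr h M) (restr h N) :=
  restr_fun (h := h) f.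

Lemma restr_hom_id (R Q : pzRingType) (h : {rmorphism R -> Q}) (M : Mod Q) :
  restr_hom h (idm M) = idm (restr h M : Mod R).
Proof. exact: linear_ext. Qed.
Lemma restr_hom_comp (R Q : pzRingType) (h : {rmorphism R -> Q})
    (L M N : Mod Q) (g : mor M N) (f : mor L M) :
  restr_hom h (g \oc f) = restr_hom h g \oc restr_hom h f.
Proof. exact: linear_ext. Qed.

Definition restr_functor (R Q : pzRingType) (h : {rmorphism R -> Q}) :
    functor (Mod Q) (Mod R) :=
  @Functor (Mod Q) (Mod R) (fun M => restr h M) (@restr_hom R Q h)
    (restr_hom_id h) (restr_hom_comp h).

(* An S-T-bimodule is presented as a right T-module with a left S-action by T-linear maps. *)
Record bimodule (S T : pzRingType) := Bimodule {
  bimod_car :> rmod T;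
  lact : S -> {linear bimod_car -> bimod_car};
  lact1 : forall p, lact 1 p = p;
  lactD : forall s t p, lact (s + t) p = lact s p + lact t p;
  lactM : forall s t p, lact (s * t) p = lact s (lact t p)
}.

(* Right S-action on Hom_T(P, M): (f s)(p) = f (s p). *)
Definition Hom (S T : pzRingType) (P : bimodule S T) (M : rmod T) : Type :=
  {linear P -> M}.

HB.instance Definition _ (S T : pzRingType) (P : bimodule S T) (M : rmod T) :=
  GRing.Zmodule.on (Hom P M).

Definition Hom_scale (S T : pzRingType) (P : bimodule S T) (M : rmod T)
  (s : S^c) (f : Hom P M) : Hom P M := lin_comp f (lact P s).

Lemma Hom_scaleA (S T : pzRingType) (P : bimodule S T) (M : rmod T)
    (a b : S^c) (f : Hom P M) :
  Hom_scale a (Hom_scale b f) = Hom_scale (a * b) f.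
Proof. by apply: linear_ext => p /=; rewrite -lactM. Qed.
Lemma Hom_scale1 (S T : pzRingType) (P : bimodule S T) (M : rmod T) :
  left_id 1 (@Hom_scale S T P M).
Proof. by move=> f; apply: linear_ext => p /=; rewrite lact1. Qed.
Lemma Hom_scaleDr (S T : pzRingType) (P : bimodule S T) (M : rmod T) :
  right_distributive (@Hom_scale S T P M) +%R.
Proof. by move=> a f g; apply: linear_ext. Qed.
Lemma Hom_scaleDl (S T : pzRingType) (P : bimodule S T) (M : rmod T)
    (f : Hom P M) : {morph (@Hom_scale S T P M)^~ f : a b / a + b}.
Proof.
by move=> a b; apply: linear_ext => p /=; rewrite lactD linearD.
Qed.

HB.instance Definition _ (S T : pzRingType) (P : bimodule S T) (M : rmod T) :=
  GRing.Zmodule_isLmodule.Build S^c (Hom P M) (@Hom_scaleA S T P M)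
    (@Hom_scale1 S T P M) (@Hom_scaleDr S T P M) (@Hom_scaleDl S T P M).

Definition Hom_fun (S T : pzRingType) (P : bimodule S T) (M N : rmod T)
  (g : {linear M -> N}) (f : Hom P M) : Hom P N := lin_comp g f.

Lemma Hom_fun_linear (S T : pzRingType) (P : bimodule S T) (M N : rmod T)
    (g : {linear M -> N}) : linear (@Hom_fun S T P M N g).
Proof. by move=> a f f'; apply: linear_ext => p; rewrite /= linearD. Qed.

HB.instance Definition _ (S T : pzRingType) (P : bimodule S T) (M N : rmod T)
    (g : {linear M -> N}) :=
  GRing.isLinear.Build S^c (Hom P M) (Hom P N) *:%R (@Hom_fun S T P M N g)
    (@Hom_fun_linear S T P M N g).

Definition Hom_hom (S T : pzRingType) (P : bimodule S T) (M N : Mod T)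
  (g : mor M N) : @mor (Mod S) (Hom P M) (Hom P N) := Hom_fun (P := P) g.

Lemma Hom_hom_id (S T : pzRingType) (P : bimodule S T) (M : Mod T) :
  Hom_hom P (idm M) = idm (Hom P M : Mod S).
Proof. by apply: linear_ext => f; apply: linear_ext. Qed.
Lemma Hom_hom_comp (S T : pzRingType) (P : bimodule S T)
    (L M N : Mod T) (g : mor M N) (f : mor L M) :
  Hom_hom P (g \oc f) = Hom_hom P g \oc Hom_hom P f.
Proof. by apply: linear_ext => h; apply: linear_ext. Qed.

Definition Hom_functor (S T : pzRingType) (P : bimodule S T) :
    functor (Mod T) (Mod S) :=
  @Functor (Mod T) (Mod S) (fun M => Hom P M) (@Hom_hom S T P)
    (Hom_hom_id P) (Hom_hom_comp P).

(* Subgroup of the free abelian group on X × P generated by the relators of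
   X ⊗_S P. *)
Inductive tens_rel (S T : pzRingType) (P : bimodule S T) (X : rmod S) :
    {freeg (X * P)%type / int} -> Prop :=
| tens_rel0 : tens_rel 0
| tens_relB u v : tens_rel u -> tens_rel v -> tens_rel (u - v)
| tens_rel_addl x y p : tens_rel (<< (x + y, p) >> - << (x, p) >> - << (y, p) >>)
| tens_rel_addr x p q : tens_rel (<< (x, p + q) >> - << (x, p) >> - << (x, q) >>)
| tens_rel_mid x s p : tens_rel (<< (ract x s, p) >> - << (x, lact P s p) >>).

Definition freeg_map (K L : choiceType) (f : K -> L) (u : {freeg K / int}) :
  {freeg L / int} := fglift (fun k => << f k >>) u.

Lemma freeg_map_is_additive (K L : choiceType) (f : K -> L) :
  zmod_morphism (freeg_map f).
Proof. exact: lift_is_additive. Qed.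

HB.instance Definition _ (K L : choiceType) (f : K -> L) :=
  GRing.isZmodMorphism.Build _ _ (freeg_map f) (freeg_map_is_additive f).

Lemma freeg_mapU (K L : choiceType) (f : K -> L) (k : K) :
  freeg_map f << k >> = << f k >>.
Proof. by rewrite /freeg_map liftU scale1r. Qed.

Lemma freeg_ind_zmod (K : choiceType) (Q : {freeg K / int} -> Prop) :
  Q 0 -> (forall u v, Q u -> Q v -> Q (u - v)) -> (forall k, Q << k >>) ->
  forall u, Q u.
Proof.
move=> Q0 QB Qg.
have QN u : Q u -> Q (- u) by rewrite -sub0r; apply: QB.
have QD u v : Q u -> Q v -> Q (u + v).
  by move=> Qu Qv; rewrite -[v]opprK; apply: QB => //; apply: QN.
have QMn u n : Q u -> Q (u *+ n).
  by move=> Qu; elim: n => // n IHn; rewrite mulrS; apply: QD.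
elim/freeg_ind_dom0 => // c x D _ _ QDD; apply: (QD) => //.
rewrite -[c]intz -freegU_mulz; case: c => n; first exact: QMn.
by apply: (QN); apply: QMn.
Qed.

Definition tens_pred (S T : pzRingType) (P : bimodule S T) (X : rmod S) :
  {pred {freeg (X * P)%type / int}} := fun u => `[< tens_rel u >].

Lemma tens_pred_zmod (S T : pzRingType) (P : bimodule S T) (X : rmod S) :
  zmod_closed (@tens_pred S T P X).
Proof.
split; first by apply/asboolP; apply: tens_rel0.
by move=> u v /asboolP ru /asboolP rv; apply/asboolP; apply: tens_relB.
Qed.

HB.instance Definition _ (S T : pzRingType) (P : bimodule S T) (X : rmod S) :=
  GRing.isZmodClosed.Build _ (@tens_pred S T P X) (@tens_pred_zmod S T P X).

Definition Tens (S T : pzRingType) (P : bimodule S T) (X : rmod S) : Type :=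
  (Quotient.quot (@tens_pred S T P X)).

HB.instance Definition _ (S T : pzRingType) (P : bimodule S T) (X : rmod S) :=
  GRing.Zmodule.on (Tens P X).

Definition tens_pi (S T : pzRingType) (P : bimodule S T) (X : rmod S)
  (u : {freeg (X * P)%type / int}) : Tens P X :=
  \pi_((Quotient.quot (@tens_pred S T P X)))%qT u.

Lemma tens_pi_is_additive (S T : pzRingType) (P : bimodule S T) (X : rmod S) :
  zmod_morphism (@tens_pi S T P X).
Proof. by move=> u v; rewrite /tens_pi raddfB. Qed.

HB.instance Definition _ (S T : pzRingType) (P : bimodule S T) (X : rmod S) :=
  GRing.isZmodMorphism.Build _ _ (@tens_pi S T P X)
    (@tens_pi_is_additive S T P X).

Definition tens (S T : pzRingType) (P : bimodule S T) (X : rmod S)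
  (x : X) (p : P) : Tens P X := tens_pi << (x, p) >>.

Lemma tens_pi_eq (S T : pzRingType) (P : bimodule S T) (X : rmod S)
    (u v : {freeg (X * P)%type / int}) :
  tens_pi u = tens_pi v <-> tens_rel (u - v).
Proof.
rewrite /tens_pi; split.
  by move=> /eqP; rewrite -Quotient.idealrBE => /asboolP.
by move=> uv; apply/eqP; rewrite -Quotient.idealrBE; apply/asboolP.
Qed.

Lemma tens_ind (S T : pzRingType) (P : bimodule S T) (X : rmod S)
    (Q : Tens P X -> Prop) :
  Q 0 -> (forall u v, Q u -> Q v -> Q (u - v)) ->
  (forall x p, Q (tens x p)) -> forall u, Q u.
Proof.
move=> Q0 QB Qt u; rewrite -[u](@reprK _ (Quotient.quot (@tens_pred S T P X))).
rewrite -/(tens_pi _); move: (repr _); apply: freeg_ind_zmod.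
- by rewrite raddf0.
- by move=> v w Qv Qw; rewrite raddfB; apply: QB.
- by case=> x p; apply: Qt.
Qed.

Lemma tensDl (S T : pzRingType) (P : bimodule S T) (X : rmod S) (x y : X)
  (p : P) : tens (x + y) p = tens x p + tens y p.
Proof.
rewrite /tens -raddfD; apply/tens_pi_eq.
by rewrite opprD addrA; apply: tens_rel_addl.
Qed.

Lemma tensDr (S T : pzRingType) (P : bimodule S T) (X : rmod S) (x : X)
  (p q : P) : tens x (p + q) = tens x p + tens x q.
Proof.
rewrite /tens -raddfD; apply/tens_pi_eq.
by rewrite opprD addrA; apply: tens_rel_addr.
Qed.

Lemma tens_mid (S T : pzRingType) (P : bimodule S T) (X : rmod S) (x : X)
  (s : S) (p : P) : tens (ract x s) p = tens x (lact P s p).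
Proof. by apply/tens_pi_eq; apply: tens_rel_mid. Qed.

Definition tens_map (S T : pzRingType) (P : bimodule S T) (X Y : rmod S)
  (f : X -> Y) (g : P -> P) (u : Tens P X) : Tens P Y :=
  tens_pi (freeg_map (fun k => (f k.1, g k.2))
    (repr (u : (Quotient.quot (@tens_pred S T P X))))).

Definition tens_compat (S T : pzRingType) (P : bimodule S T) (X Y : rmod S)
    (f : X -> Y) (g : P -> P) : Prop :=
  [/\ {morph f : x y / x + y}, {morph g : p q / p + q},
      (forall x s, f (ract x s) = ract (f x) s)
    & (forall s p, g (lact P s p) = lact P s (g p))].

Lemma tens_map_pi (S T : pzRingType) (P : bimodule S T) (X Y : rmod S)
    (f : X -> Y) (g : P -> P) (u : {freeg (X * P)%type / int}) :
  tens_compat f g ->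
  tens_map f g (tens_pi u) = tens_pi (freeg_map (fun k => (f k.1, g k.2)) u).
Proof.
case=> fD gD fM gM; apply/tens_pi_eq; rewrite -raddfB.
have : tens_rel (repr (tens_pi u : (Quotient.quot (@tens_pred S T P X))) - u).
  apply/tens_pi_eq; exact: (@reprK _ (Quotient.quot (@tens_pred S T P X))).
elim=> [|v w _ IHv _ IHw|x y p|x p q|x s p]; rewrite ?raddf0 ?raddfB /=.
- exact: tens_rel0.
- exact: tens_relB.
- by rewrite !freeg_mapU /= fD; apply: tens_rel_addl.
- by rewrite !freeg_mapU /= gD; apply: tens_rel_addr.
- by rewrite !freeg_mapU /= fM gM; apply: tens_rel_mid.
Qed.

Lemma tens_mapE (S T : pzRingType) (P : bimodule S T) (X Y : rmod S)
    (f : X -> Y) (g : P -> P) (x : X) (p : P) :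
  tens_compat f g -> tens_map f g (tens x p) = tens (f x) (g p).
Proof. by move=> cfg; rewrite tens_map_pi // freeg_mapU. Qed.

Lemma tens_mapB (S T : pzRingType) (P : bimodule S T) (X Y : rmod S)
    (f : X -> Y) (g : P -> P) :
  tens_compat f g -> zmod_morphism (@tens_map S T P X Y f g).
Proof.
move=> cfg u v.
rewrite -[u](@reprK _ (Quotient.quot (@tens_pred S T P X))).
rewrite -[v](@reprK _ (Quotient.quot (@tens_pred S T P X))).
rewrite -/(tens_pi (repr u)) -/(tens_pi (repr v)) -raddfB.
by rewrite !(tens_map_pi _ cfg) !raddfB.
Qed.

Lemma tens_map0 (S T : pzRingType) (P : bimodule S T) (X Y : rmod S)
    (f : X -> Y) (g : P -> P) : tens_compat f g -> @tens_map S T P X Y f g 0 = 0.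
Proof. by move=> cfg; rewrite -[0 in LHS](subrr 0) tens_mapB // subrr. Qed.

Definition tens_scale (S T : pzRingType) (P : bimodule S T) (X : rmod S)
  (t : T^c) (u : Tens P X) : Tens P X := tens_map idfun (fun p => t *: p) u.

Lemma tens_scale_compat (S T : pzRingType) (P : bimodule S T) (X : rmod S)
  (t : T^c) : @tens_compat S T P X X idfun (fun p => t *: p).
Proof. by split=> // [p q|s p]; rewrite ?scalerDr ?linearZ. Qed.

Lemma tens_scaleE (S T : pzRingType) (P : bimodule S T) (X : rmod S)
  (t : T^c) (x : X) (p : P) : tens_scale t (tens x p) = tens x (t *: p).
Proof. exact: tens_mapE (tens_scale_compat P X t). Qed.

Lemma tens_scaleB (S T : pzRingType) (P : bimodule S T) (X : rmod S)
  (t : T^c) : zmod_morphism (@tens_scale S T P X t).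
Proof. exact: tens_mapB (tens_scale_compat P X t). Qed.

Lemma tens_scale0 (S T : pzRingType) (P : bimodule S T) (X : rmod S)
  (t : T^c) : @tens_scale S T P X t 0 = 0.
Proof. exact: tens_map0 (tens_scale_compat P X t). Qed.

Lemma tens_scaleA (S T : pzRingType) (P : bimodule S T) (X : rmod S)
    (a b : T^c) (u : Tens P X) :
  tens_scale a (tens_scale b u) = tens_scale (a * b) u.
Proof.
elim/tens_ind: u => [|u v IHu IHv|x p]; first by rewrite !tens_scale0.
- by rewrite !tens_scaleB IHu IHv.
- by rewrite !tens_scaleE scalerA.
Qed.

Lemma tens_scale1 (S T : pzRingType) (P : bimodule S T) (X : rmod S) :
  left_id 1 (@tens_scale S T P X).
Proof.
elim/tens_ind => [|u v IHu IHv|x p]; first by rewrite !tens_scale0.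
- by rewrite !tens_scaleB IHu IHv.
- by rewrite !tens_scaleE scale1r.
Qed.

Lemma tens_scaleDr (S T : pzRingType) (P : bimodule S T) (X : rmod S) :
  right_distributive (@tens_scale S T P X) +%R.
Proof.
move=> a u v; rewrite -[in LHS](opprK v) tens_scaleB -[- v]sub0r tens_scaleB.
by rewrite tens_scale0 sub0r opprK.
Qed.

Lemma tens_scaleDl (S T : pzRingType) (P : bimodule S T) (X : rmod S)
    (u : Tens P X) : {morph (@tens_scale S T P X)^~ u : a b / a + b}.
Proof.
move=> a b; elim/tens_ind: u => [|u v IHu IHv|x p].
- by rewrite !tens_scale0 addr0.
- by rewrite !tens_scaleB IHu IHv opprD addrACA.
- by rewrite !tens_scaleE scalerDl tensDr.
Qed.

HB.instance Definition _ (S T : pzRingType) (P : bimodule S T) (X : rmod S) :=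
  GRing.Zmodule_isLmodule.Build T^c (Tens P X) (@tens_scaleA S T P X)
    (@tens_scale1 S T P X) (@tens_scaleDr S T P X) (@tens_scaleDl S T P X).

Definition Tens_fun (S T : pzRingType) (P : bimodule S T) (X Y : rmod S)
  (f : {linear X -> Y}) (u : Tens P X) : Tens P Y := tens_map f idfun u.

Lemma Tens_fun_compat (S T : pzRingType) (P : bimodule S T) (X Y : rmod S)
  (f : {linear X -> Y}) : @tens_compat S T P X Y f idfun.
Proof. by split=> // [x y|x s]; rewrite ?linearD // /ract linearZ. Qed.

Lemma Tens_funE (S T : pzRingType) (P : bimodule S T) (X Y : rmod S)
  (f : {linear X -> Y}) (x : X) (p : P) :
  Tens_fun f (tens x p) = tens (f x) p.
Proof. exact: tens_mapE (Tens_fun_compat P f). Qed.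

Lemma Tens_fun_linear (S T : pzRingType) (P : bimodule S T) (X Y : rmod S)
  (f : {linear X -> Y}) : linear (@Tens_fun S T P X Y f).
Proof.
have fB : zmod_morphism (@Tens_fun S T P X Y f).
  exact: tens_mapB (Tens_fun_compat P f).
have f0 : @Tens_fun S T P X Y f 0 = 0.
  exact: tens_map0 (Tens_fun_compat P f).
have fD u v : Tens_fun (P := P) f (u + v) = Tens_fun f u + Tens_fun f v.
  by rewrite -[in LHS](opprK v) fB -[- v]sub0r fB f0 sub0r opprK.
move=> a u v; rewrite fD; congr (_ + _).
elim/tens_ind: u => [|u w IHu IHw|x p]; first by rewrite !(scaler0, f0).
- by rewrite scalerBr !fB IHu IHw scalerBr.
- rewrite -[_ *: tens x p]/(tens_scale _ _) tens_scaleE !Tens_funE.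
  by rewrite -[RHS]/(tens_scale _ _) tens_scaleE.
Qed.

HB.instance Definition _ (S T : pzRingType) (P : bimodule S T) (X Y : rmod S)
    (f : {linear X -> Y}) :=
  GRing.isLinear.Build T^c (Tens P X) (Tens P Y) *:%R (@Tens_fun S T P X Y f)
    (@Tens_fun_linear S T P X Y f).

Definition Tens_hom (S T : pzRingType) (P : bimodule S T) (X Y : Mod S)
  (f : mor X Y) : @mor (Mod T) (Tens P X) (Tens P Y) := Tens_fun (P := P) f.

Lemma Tens_hom_id (S T : pzRingType) (P : bimodule S T) (X : Mod S) :
  Tens_hom P (idm X) = idm (Tens P X : Mod T).
Proof.
apply: linear_ext; elim/tens_ind => [|u v IHu IHv|x p]; first by rewrite !raddf0.
- by rewrite [LHS]raddfB [RHS]raddfB; congr (_ - _).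
- exact: Tens_funE.
Qed.

Lemma Tens_hom_comp (S T : pzRingType) (P : bimodule S T)
    (X Y Z : Mod S) (g : mor Y Z) (f : mor X Y) :
  Tens_hom P (g \oc f) = Tens_hom P g \oc Tens_hom P f.
Proof.
apply: linear_ext; elim/tens_ind => [|u v IHu IHv|x p]; first by rewrite !raddf0.
- by rewrite [LHS]raddfB [RHS]raddfB; congr (_ - _).
- by rewrite /= !Tens_funE.
Qed.

Definition Tens_functor (S T : pzRingType) (P : bimodule S T) :
    functor (Mod S) (Mod T) :=
  @Functor (Mod S) (Mod T) (fun X => Tens P X) (@Tens_hom S T P)
    (Tens_hom_id P) (Tens_hom_comp P).

Record ideal (R : pzRingType) := Ideal {
  ideal_pred :> {pred R};
  ideal_zmod : zmod_closed ideal_pred;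
  idealMl : forall a x, x \in ideal_pred -> a * x \in ideal_pred;
  idealMr : forall a x, x \in ideal_pred -> x * a \in ideal_pred
}.

HB.instance Definition _ (R : pzRingType) (I : ideal R) :=
  GRing.isZmodClosed.Build R (ideal_pred I) (ideal_zmod I).

Definition quotient_ring (R : pzRingType) (I : ideal R) : Type :=
  Quotient.quot (ideal_pred I).

HB.instance Definition _ (R : pzRingType) (I : ideal R) :=
  GRing.Zmodule.on (quotient_ring I).

Definition qpi (R : pzRingType) (I : ideal R) (x : R) : quotient_ring I :=
  \pi_(Quotient.quot (ideal_pred I))%qT x.

Definition qrepr (R : pzRingType) (I : ideal R) (u : quotient_ring I) : R :=
  repr (u : Quotient.quot (ideal_pred I)).

Lemma qreprK (R : pzRingType) (I : ideal R) : cancel (@qrepr R I) (@qpi R I).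
Proof. by move=> u; apply: (@reprK _ (Quotient.quot (ideal_pred I))). Qed.

Lemma qpi_eq (R : pzRingType) (I : ideal R) (x y : R) :
  qpi I x = qpi I y <-> x - y \in ideal_pred I.
Proof.
rewrite /qpi; split; first by move=> /eqP; rewrite -Quotient.idealrBE.
by move=> xy; apply/eqP; rewrite -Quotient.idealrBE.
Qed.

Lemma qpi_is_additive (R : pzRingType) (I : ideal R) :
  zmod_morphism (@qpi R I).
Proof. by move=> u v; rewrite /qpi raddfB. Qed.

HB.instance Definition _ (R : pzRingType) (I : ideal R) :=
  GRing.isZmodMorphism.Build _ _ (@qpi R I) (@qpi_is_additive R I).

Definition qmul (R : pzRingType) (I : ideal R) (u v : quotient_ring I) :
  quotient_ring I := qpi I (qrepr u * qrepr v).

Lemma qmulE (R : pzRingType) (I : ideal R) (x y : R) :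
  qmul (qpi I x) (qpi I y) = qpi I (x * y).
Proof.
apply/qpi_eq; set x' := qrepr _; set y' := qrepr _.
have -> : x' * y' - x * y = x' * (y' - y) + (x' - x) * y.
  by rewrite mulrBr mulrBl addrA subrK.
apply: rpredD; [apply: idealMl | apply: idealMr];
  by apply/qpi_eq; apply: qreprK.
Qed.

Lemma qmulA (R : pzRingType) (I : ideal R) : associative (@qmul R I).
Proof.
move=> u v w; rewrite -(qreprK u) -(qreprK v) -(qreprK w).
by rewrite !qmulE mulrA.
Qed.
Lemma qmul1l (R : pzRingType) (I : ideal R) : left_id (qpi I 1) (@qmul R I).
Proof. by move=> u; rewrite -(qreprK u) qmulE mul1r. Qed.
Lemma qmul1r (R : pzRingType) (I : ideal R) : right_id (qpi I 1) (@qmul R I).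
Proof. by move=> u; rewrite -(qreprK u) qmulE mulr1. Qed.
Lemma qmulDl (R : pzRingType) (I : ideal R) :
  left_distributive (@qmul R I) +%R.
Proof.
move=> u v w; rewrite -(qreprK u) -(qreprK v) -(qreprK w).
by rewrite -raddfD !qmulE mulrDl raddfD.
Qed.
Lemma qmulDr (R : pzRingType) (I : ideal R) :
  right_distributive (@qmul R I) +%R.
Proof.
move=> u v w; rewrite -(qreprK u) -(qreprK v) -(qreprK w).
by rewrite -raddfD !qmulE mulrDr raddfD.
Qed.

HB.instance Definition _ (R : pzRingType) (I : ideal R) :=
  GRing.Zmodule_isPzRing.Build (quotient_ring I) (@qmulA R I) (@qmul1l R I)
    (@qmul1r R I) (@qmulDl R I) (@qmulDr R I).

Lemma qpi_is_monoid_morphism (R : pzRingType) (I : ideal R) :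
  monoid_morphism (@qpi R I).
Proof. by split=> // x y; rewrite -[RHS]/(qmul _ _) qmulE. Qed.

HB.instance Definition _ (R : pzRingType) (I : ideal R) :=
  GRing.isMonoidMorphism.Build R (quotient_ring I) (@qpi R I)
    (@qpi_is_monoid_morphism R I).

Definition regular_rmod (R : pzRingType) : rmod R := (R^c)^o.

Definition lmul_fun (R : pzRingType) (r x : regular_rmod R) : regular_rmod R :=
  (r : R) * (x : R).

Lemma lmul_linear (R : pzRingType) (r : R) : linear (@lmul_fun R r).
Proof.
move=> a x y; rewrite /lmul_fun mulrDr; congr (_ + _).
exact: (mulrA r (x : R) (a : R)).
Qed.

HB.instance Definition _ (R : pzRingType) (r : R) :=
  GRing.isLinear.Build R^c (regular_rmod R) (regular_rmod R) *:%R
    (@lmul_fun R r) (@lmul_linear R r).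

Definition lmul (R : pzRingType) (r : R) :
  {linear regular_rmod R -> regular_rmod R} := @lmul_fun R r.

Lemma quot_lact1 (R : pzRingType) (I : ideal R)
  (x : regular_rmod (quotient_ring I)) : lmul (qpi I 1) x = x.
Proof. by rewrite rmorph1; apply: (mul1r (x : quotient_ring I)). Qed.
Lemma quot_lactD (R : pzRingType) (I : ideal R) (s t : R)
  (x : regular_rmod (quotient_ring I)) :
  lmul (qpi I (s + t)) x = lmul (qpi I s) x + lmul (qpi I t) x.
Proof. by rewrite rmorphD; apply: (mulrDl _ _ (x : quotient_ring I)). Qed.
Lemma quot_lactM (R : pzRingType) (I : ideal R) (s t : R)
  (x : regular_rmod (quotient_ring I)) :
  lmul (qpi I (s * t)) x = lmul (qpi I s) (lmul (qpi I t) x).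
Proof. by rewrite rmorphM; apply/esym/(mulrA _ _ (x : quotient_ring I)). Qed.

Definition quot_bimod_left (R : pzRingType) (I : ideal R) :
    bimodule R (quotient_ring I) :=
  @Bimodule R (quotient_ring I) (regular_rmod (quotient_ring I))
    (fun r => lmul (qpi I r))
    (@quot_lact1 R I) (@quot_lactD R I) (@quot_lactM R I).

Definition quot_bimod_right (R : pzRingType) (I : ideal R) :
    bimodule (quotient_ring I) R :=
  @Bimodule (quotient_ring I) R
    (restr (@qpi R I) (regular_rmod (quotient_ring I)))
    (fun u => restr_hom (@qpi R I) (lmul u))
    (fun x => mul1r (x : quotient_ring I))
    (fun u v x => mulrDl u v (x : quotient_ring I))
    (fun u v x => esym (mulrA u v (x : quotient_ring I))).

Record idempotent_elt (S : pzRingType) := Idempotent {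
  idem_val :> S;
  idemE : idem_val * idem_val = idem_val
}.

Definition SeS_pred (S : pzRingType) (e : S) : {pred S} :=
  fun x => `[< exists s : seq (S * S), x = \sum_(p <- s) p.1 * e * p.2 >].

Lemma SeS_zmod (S : pzRingType) (e : S) : zmod_closed (SeS_pred e).
Proof.
split; first by apply/asboolP; exists [::]; rewrite big_nil.
move=> _ _ /asboolP [s ->] /asboolP [t ->]; apply/asboolP.
exists (s ++ [seq (- p.1, p.2) | p <- t]).
rewrite big_cat big_map /= -sumrN; congr (_ + _).
by apply: eq_bigr => p _; rewrite !mulNr.
Qed.
Lemma SeS_Ml (S : pzRingType) (e a x : S) :
  x \in SeS_pred e -> a * x \in SeS_pred e.
Proof.
move=> /asboolP [s ->]; apply/asboolP; exists [seq (a * p.1, p.2) | p <- s].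
by rewrite big_map mulr_sumr; apply: eq_bigr => p _; rewrite !mulrA.
Qed.
Lemma SeS_Mr (S : pzRingType) (e a x : S) :
  x \in SeS_pred e -> x * a \in SeS_pred e.
Proof.
move=> /asboolP [s ->]; apply/asboolP; exists [seq (p.1, p.2 * a) | p <- s].
by rewrite big_map mulr_suml; apply: eq_bigr => p _; rewrite !mulrA.
Qed.

Definition SeS (S : pzRingType) (e : S) : ideal S :=
  Ideal (SeS_zmod e) (@SeS_Ml S e) (@SeS_Mr S e).

Definition corner_pred (S : pzRingType) (e : S) : {pred S} :=
  fun x => e * x * e == x.
Definition eS_pred (S : pzRingType) (e : S) : {pred S} := fun x => e * x == x.
Definition Se_pred (S : pzRingType) (e : S) : {pred S} := fun x => x * e == x.

Lemma corner_zmod (S : pzRingType) (e : S) : zmod_closed (corner_pred e).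
Proof.
split=> [|x y]; rewrite !unfold_in ?mulr0 ?mul0r // => /eqP xP /eqP yP.
by rewrite mulrBr mulrBl xP yP.
Qed.
Lemma eS_zmod (S : pzRingType) (e : S) : zmod_closed (eS_pred e).
Proof.
split=> [|x y]; rewrite !unfold_in ?mulr0 ?mul0r // => /eqP xP /eqP yP.
by rewrite mulrBr xP yP.
Qed.
Lemma Se_zmod (S : pzRingType) (e : S) : zmod_closed (Se_pred e).
Proof.
split=> [|x y]; rewrite !unfold_in ?mulr0 ?mul0r // => /eqP xP /eqP yP.
by rewrite mulrBl xP yP.
Qed.

HB.instance Definition _ (S : pzRingType) (e : S) :=
  GRing.isZmodClosed.Build S (corner_pred e) (corner_zmod e).
HB.instance Definition _ (S : pzRingType) (e : S) :=
  GRing.isZmodClosed.Build S (eS_pred e) (eS_zmod e).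
HB.instance Definition _ (S : pzRingType) (e : S) :=
  GRing.isZmodClosed.Build S (Se_pred e) (Se_zmod e).

Record corner (S : pzRingType) (e : idempotent_elt S) :=
  Corner { corner_val :> S; cornerP : corner_val \in corner_pred e }.
HB.instance Definition _ (S : pzRingType) (e : idempotent_elt S) :=
  [isSub for @corner_val S e].
HB.instance Definition _ (S : pzRingType) (e : idempotent_elt S) :=
  [Choice of corner e by <:].
HB.instance Definition _ (S : pzRingType) (e : idempotent_elt S) :=
  [SubChoice_isSubZmodule of corner e by <:].

Record eS (S : pzRingType) (e : idempotent_elt S) :=
  ESElt { eS_val :> S; eSP : eS_val \in eS_pred e }.
HB.instance Definition _ (S : pzRingType) (e : idempotent_elt S) :=
  [isSub for @eS_val S e].
HB.instance Definition _ (S : pzRingType) (e : idempotent_elt S) :=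
  [Choice of eS e by <:].
HB.instance Definition _ (S : pzRingType) (e : idempotent_elt S) :=
  [SubChoice_isSubZmodule of eS e by <:].

Record Se (S : pzRingType) (e : idempotent_elt S) :=
  SeElt { Se_val :> S; SeP : Se_val \in Se_pred e }.
HB.instance Definition _ (S : pzRingType) (e : idempotent_elt S) :=
  [isSub for @Se_val S e].
HB.instance Definition _ (S : pzRingType) (e : idempotent_elt S) :=
  [Choice of Se e by <:].
HB.instance Definition _ (S : pzRingType) (e : idempotent_elt S) :=
  [SubChoice_isSubZmodule of Se e by <:].

Lemma corner_l (S : pzRingType) (e : idempotent_elt S) (x : corner e) :
  (e : S) * (x : S) = (x : S).
Proof. by have /eqP <- := cornerP x; rewrite !mulrA idemE. Qed.
Lemma corner_r (S : pzRingType) (e : idempotent_elt S) (x : corner e) :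
  (x : S) * (e : S) = (x : S).
Proof. by have /eqP <- := cornerP x; rewrite -!mulrA idemE. Qed.
Lemma eSl (S : pzRingType) (e : idempotent_elt S) (x : eS e) :
  (e : S) * (x : S) = (x : S).
Proof. exact/eqP/(eSP x). Qed.
Lemma Ser (S : pzRingType) (e : idempotent_elt S) (x : Se e) :
  (x : S) * (e : S) = (x : S).
Proof. exact/eqP/(SeP x). Qed.

Lemma corner_one_subproof (S : pzRingType) (e : idempotent_elt S) :
  (e : S) \in corner_pred e.
Proof. by rewrite unfold_in !idemE. Qed.
Definition corner_one (S : pzRingType) (e : idempotent_elt S) : corner e :=
  Corner (corner_one_subproof e).

Lemma corner_mul_subproof (S : pzRingType) (e : idempotent_elt S) (x y : corner e) :
  (x : S) * (y : S) \in corner_pred e.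
Proof. by rewrite unfold_in mulrA corner_l -mulrA corner_r. Qed.
Definition corner_mul (S : pzRingType) (e : idempotent_elt S) (x y : corner e) :
  corner e := Corner (corner_mul_subproof x y).

Lemma corner_mulA (S : pzRingType) (e : idempotent_elt S) :
  associative (@corner_mul S e).
Proof. by move=> x y z; apply: val_inj; apply: mulrA. Qed.
Lemma corner_mul1l (S : pzRingType) (e : idempotent_elt S) :
  left_id (corner_one e) (@corner_mul S e).
Proof. by move=> x; apply: val_inj; apply: corner_l. Qed.
Lemma corner_mul1r (S : pzRingType) (e : idempotent_elt S) :
  right_id (corner_one e) (@corner_mul S e).
Proof. by move=> x; apply: val_inj; apply: corner_r. Qed.
Lemma corner_mulDl (S : pzRingType) (e : idempotent_elt S) :
  left_distributive (@corner_mul S e) +%R.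
Proof. by move=> x y z; apply: val_inj; apply: mulrDl. Qed.
Lemma corner_mulDr (S : pzRingType) (e : idempotent_elt S) :
  right_distributive (@corner_mul S e) +%R.
Proof. by move=> x y z; apply: val_inj; apply: mulrDr. Qed.

HB.instance Definition _ (S : pzRingType) (e : idempotent_elt S) :=
  GRing.Zmodule_isPzRing.Build (corner e) (@corner_mulA S e) (@corner_mul1l S e)
    (@corner_mul1r S e) (@corner_mulDl S e) (@corner_mulDr S e).

Lemma eS_scale_subproof (S : pzRingType) (e : idempotent_elt S) (s : S) (x : eS e) :
  (x : S) * s \in eS_pred e.
Proof. by rewrite unfold_in mulrA eSl. Qed.
Definition eS_scale (S : pzRingType) (e : idempotent_elt S) (s : S^c) (x : eS e) :
  eS e := ESElt (@eS_scale_subproof S e s x).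

Lemma eS_scaleA (S : pzRingType) (e : idempotent_elt S) (a b : S^c) (x : eS e) :
  eS_scale a (eS_scale b x) = eS_scale (a * b) x.
Proof. by apply: val_inj; rewrite /= -mulrA. Qed.
Lemma eS_scale1 (S : pzRingType) (e : idempotent_elt S) : left_id 1 (@eS_scale S e).
Proof. by move=> x; apply: val_inj; apply: mulr1. Qed.
Lemma eS_scaleDr (S : pzRingType) (e : idempotent_elt S) :
  right_distributive (@eS_scale S e) +%R.
Proof. by move=> a x y; apply: val_inj; apply: mulrDl. Qed.
Lemma eS_scaleDl (S : pzRingType) (e : idempotent_elt S) (x : eS e) :
  {morph (@eS_scale S e)^~ x : a b / a + b}.
Proof. by move=> a b; apply: val_inj; apply: mulrDr. Qed.

HB.instance Definition _ (S : pzRingType) (e : idempotent_elt S) :=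
  GRing.Zmodule_isLmodule.Build S^c (eS e) (@eS_scaleA S e)
    (@eS_scale1 S e) (@eS_scaleDr S e) (@eS_scaleDl S e).

Lemma eS_lact_subproof (S : pzRingType) (e : idempotent_elt S) (a : corner e)
  (x : eS e) : (a : S) * (x : S) \in eS_pred e.
Proof. by rewrite unfold_in mulrA corner_l. Qed.
Definition eS_lact (S : pzRingType) (e : idempotent_elt S) (a : corner e)
  (x : eS e) : eS e := ESElt (eS_lact_subproof a x).

Lemma eS_lact_linear (S : pzRingType) (e : idempotent_elt S) (a : corner e) :
  linear (eS_lact a).
Proof.
move=> s x y; apply: val_inj; rewrite /= mulrDr; congr (_ + _).
exact: (mulrA (a : S) (x : S) (s : S)).
Qed.

HB.instance Definition _ (S : pzRingType) (e : idempotent_elt S) (a : corner e) :=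
  GRing.isLinear.Build S^c (eS e) (eS e) *:%R (eS_lact a) (eS_lact_linear a).

Lemma eS_lact1 (S : pzRingType) (e : idempotent_elt S) (x : eS e) :
  eS_lact 1 x = x.
Proof. by apply: val_inj; apply: eSl. Qed.
Lemma eS_lactD (S : pzRingType) (e : idempotent_elt S) (a b : corner e) (x : eS e) :
  eS_lact (a + b) x = eS_lact a x + eS_lact b x.
Proof. by apply: val_inj; apply: mulrDl. Qed.
Lemma eS_lactM (S : pzRingType) (e : idempotent_elt S) (a b : corner e) (x : eS e) :
  eS_lact (a * b) x = eS_lact a (eS_lact b x).
Proof. by apply: val_inj; rewrite /= mulrA. Qed.

Definition eS_bimod (S : pzRingType) (e : idempotent_elt S) :
    bimodule (corner e) S :=
  @Bimodule (corner e) S (eS e) (fun a => eS_lact a)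
    (@eS_lact1 S e) (@eS_lactD S e) (@eS_lactM S e).

Lemma Se_scale_subproof (S : pzRingType) (e : idempotent_elt S) (a : corner e)
  (x : Se e) : (x : S) * (a : S) \in Se_pred e.
Proof. by rewrite unfold_in -mulrA corner_r. Qed.
Definition Se_scale (S : pzRingType) (e : idempotent_elt S) (a : (corner e)^c)
  (x : Se e) : Se e := SeElt (@Se_scale_subproof S e a x).

Lemma Se_scaleA (S : pzRingType) (e : idempotent_elt S) (a b : (corner e)^c)
  (x : Se e) : Se_scale a (Se_scale b x) = Se_scale (a * b) x.
Proof. by apply: val_inj; rewrite /= -mulrA. Qed.
Lemma Se_scale1 (S : pzRingType) (e : idempotent_elt S) : left_id 1 (@Se_scale S e).
Proof. by move=> x; apply: val_inj; apply: Ser. Qed.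
Lemma Se_scaleDr (S : pzRingType) (e : idempotent_elt S) :
  right_distributive (@Se_scale S e) +%R.
Proof. by move=> a x y; apply: val_inj; apply: mulrDl. Qed.
Lemma Se_scaleDl (S : pzRingType) (e : idempotent_elt S) (x : Se e) :
  {morph (@Se_scale S e)^~ x : a b / a + b}.
Proof. by move=> a b; apply: val_inj; apply: mulrDr. Qed.

HB.instance Definition _ (S : pzRingType) (e : idempotent_elt S) :=
  GRing.Zmodule_isLmodule.Build (corner e)^c (Se e) (@Se_scaleA S e)
    (@Se_scale1 S e) (@Se_scaleDr S e) (@Se_scaleDl S e).

Lemma Se_lact_subproof (S : pzRingType) (e : idempotent_elt S) (s : S) (x : Se e) :
  s * (x : S) \in Se_pred e.
Proof. by rewrite unfold_in -mulrA Ser. Qed.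
Definition Se_lact (S : pzRingType) (e : idempotent_elt S) (s : S) (x : Se e) :
  Se e := SeElt (Se_lact_subproof s x).

Lemma Se_lact_linear (S : pzRingType) (e : idempotent_elt S) (s : S) :
  linear (@Se_lact S e s).
Proof.
move=> a x y; apply: val_inj; rewrite /= mulrDr; congr (_ + _).
exact: (mulrA s (x : S) (corner_val a)).
Qed.

HB.instance Definition _ (S : pzRingType) (e : idempotent_elt S) (s : S) :=
  GRing.isLinear.Build (corner e)^c (Se e) (Se e) *:%R (@Se_lact S e s)
    (@Se_lact_linear S e s).

Lemma Se_lact1 (S : pzRingType) (e : idempotent_elt S) (x : Se e) :
  Se_lact 1 x = x.
Proof. by apply: val_inj; apply: mul1r. Qed.
Lemma Se_lactD (S : pzRingType) (e : idempotent_elt S) (s t : S) (x : Se e) :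
  Se_lact (s + t) x = Se_lact s x + Se_lact t x.
Proof. by apply: val_inj; apply: mulrDl. Qed.
Lemma Se_lactM (S : pzRingType) (e : idempotent_elt S) (s t : S) (x : Se e) :
  Se_lact (s * t) x = Se_lact s (Se_lact t x).
Proof. by apply: val_inj; rewrite /= mulrA. Qed.

Definition Se_bimod (S : pzRingType) (e : idempotent_elt S) :
    bimodule S (corner e) :=
  @Bimodule S (corner e) (Se e) (fun s => @Se_lact S e s)
    (@Se_lact1 S e) (@Se_lactD S e) (@Se_lactM S e).

Definition idempotent_functors (S : pzRingType) (e : idempotent_elt S) :
    recollement_functors (Mod (quotient_ring (SeS e))) (Mod S)
                         (Mod (corner e)) :=
  {| i_lower_star := restr_functor (@qpi S (SeS e));
     i_upper_star := Tens_functor (quot_bimod_left (SeS e));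
     i_upper_shriek := Hom_functor (quot_bimod_right (SeS e));
     j_upper_star := Hom_functor (eS_bimod e);
     j_lower_shriek := Tens_functor (eS_bimod e);
     j_lower_star := Hom_functor (Se_bimod e) |}.

Definition induced_by_idempotent (S : pzRingType) (e : idempotent_elt S)
    (R : recollement (Mod (quotient_ring (SeS e))) (Mod S) (Mod (corner e))) :
    Prop :=
  rec_functors R = idempotent_functors e.

Definition submodule (R : pzRingType) (M : lmodType R) (N : M -> Prop) : Prop :=
  [/\ N 0, (forall x y, N x -> N y -> N (x + y))
    & (forall a x, N x -> N (a *: x))].

Definition right_ideal (R : pzRingType) (I : R -> Prop) : Prop :=
  @submodule R^c (regular_rmod R) I.

Definition maximal_right_ideal (R : pzRingType) (m : R -> Prop) : Prop :=
  [/\ right_ideal m, ~ (forall x, m x)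
    & forall I : R -> Prop, right_ideal I -> (forall x, m x -> I x) ->
        (forall x, I x -> m x) \/ (forall x, I x)].

Definition jacobson_pred (R : pzRingType) : {pred R} :=
  fun x => `[< forall m : R -> Prop, maximal_right_ideal m -> m x >].

Lemma jacobson_zmod (R : pzRingType) : zmod_closed (@jacobson_pred R).
Proof.
split; first by apply/asboolP => m [[]].
move=> x y /asboolP xJ /asboolP yJ; apply/asboolP => m mP.
have [[_ mD mZ] _ _] := mP; apply: mD; first exact: xJ.
have := mZ (- 1 : R^c) y (yJ m mP).
by rewrite -[_ *: _]/((y : R) * (- 1)) mulrN1.
Qed.

Lemma jacobson_Mr (R : pzRingType) (a x : R) :
  x \in @jacobson_pred R -> x * a \in @jacobson_pred R.
Proof.
move=> /asboolP xJ; apply/asboolP => m mP.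
by have [[_ _ mZ] _ _] := mP; apply: (mZ (a : R^c) x); apply: xJ.
Qed.

Lemma jacobson_Ml (R : pzRingType) (a x : R) :
  x \in @jacobson_pred R -> a * x \in @jacobson_pred R.
Proof.
move=> /asboolP xJ; apply/asboolP => m mP.
have [[m0 mD mZ] mT mmax] := mP.
have mM y b : m y -> m (y * b) by exact: (mZ (b : R^c) y).
have mB y z : m y -> m z -> m (y - z).
  by move=> my mz; apply: mD => //; rewrite -mulrN1; apply: mM.
have [ma|Nma] := EM (m a); first exact: mM.
apply: (xJ (fun y => m (a * y))); split.
- split; first by rewrite mulr0.
  + by move=> y z my mz; rewrite mulrDr; apply: mD.
  + by move=> b y my; rewrite -[b *: y]/((y : R) * b) mulrA; apply: mM.
- by move=> /(_ 1); rewrite mulr1.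
move=> I [I0 ID IZ] mI; have [|/existsNP [y /not_implyP [Iy Nmay]]] :=
  EM (forall y, I y -> m (a * y)); first by left.
right.
have [] := mmax (fun z => exists b c, m b /\ z = b + a * y * c).
- split; first by exists 0, 0; rewrite mulr0 addr0.
  + move=> _ _ [b [c [mb ->]]] [b' [c' [mb' ->]]].
    by exists (b + b'), (c + c'); rewrite mulrDr addrACA; split; first exact: mD.
  + move=> r _ [b [c [mb ->]]]; exists (b * r), (c * r); split; first exact: mM.
    by rewrite -[_ *: _]/((b + a * y * c) * (r : R)) mulrDl !mulrA.
- by move=> z mz; exists z, 0; rewrite mulr0 addr0.
- by move=> H; case: Nmay; apply: H; exists 0, 1; rewrite mulr1 add0r.
move=> /(_ a) [b [c [mb aE]]] x'.
have I1 : I 1.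
  have -> : 1 = (1 - y * c) + y * c :> R by rewrite subrK.
  apply: ID; last exact: (IZ (c : R^c) y).
  apply: mI; rewrite mulrBr mulr1 mulrA.
  by rewrite [X in X - _]aE addrK.
by rewrite -[x']mul1r; apply: (IZ (x' : R^c) 1).
Qed.

Definition jacobson (R : pzRingType) : ideal R :=
  Ideal (@jacobson_zmod R) (@jacobson_Ml R) (@jacobson_Mr R).

(* I^n = 0, i.e. every product of n elements of I vanishes. *)
Definition nilpotent_ideal (R : pzRingType) (I : ideal R) : Prop :=
  exists n : nat, forall s : seq R, size s = n -> all (mem I) s ->
    \prod_(x <- s) x = 0.

Definition semisimple_module (R : pzRingType) (M : lmodType R) : Prop :=
  forall N : M -> Prop, submodule N ->
    exists N' : M -> Prop, [/\ submodule N',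
      (forall x, N x -> N' x -> x = 0)
      & (forall x, exists y z, [/\ N y, N' z & x = y + z])].

Definition semisimple_ring (R : pzRingType) : Prop :=
  semisimple_module (regular_rmod R).

Definition semiprimary (R : pzRingType) : Prop :=
  nilpotent_ideal (jacobson R) /\ semisimple_ring (quotient_ring (jacobson R)).

(* Main.v *)
(** A functor with both adjoints is exact, so the maps it inverts are those
    whose kernel and cokernel it kills.  Hence a recollement is determined up
    to equivalence by the kernel of j^*: if an equivalence Phi matches the
    kernels of j^* and j'^*, then Theta = j'^* Phi j_* is an equivalence with
    Theta j^* = j'^* Phi, the comparison being j'^* Phi applied to the unit
    X -> j_* j^* X.

    If C is a module category Mod-T, then G = j^* is represented by P = j_!(T).
    Since G has a right adjoint, G P is spanned by the images of the maps
    G A -> G P induced by the maps A -> P; expressing the universal element of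
    G P in this way gives a finite dual basis of P.  With Q = A + P, S = End(Q)
    and e the projection onto P, the functor Hom(Q, -) is an equivalence from
    Mod-A to Mod-S, and Hom(Q, X) e = 0 means Hom(P, X) = 0, i.e. j^* X = 0.

    In general, the kernel of j^* consists of the modules annihilated by the
    ideal I = Ker (A -> i_* i^* A), and it is closed under extensions, so it
    contains every module annihilated by a power of I.  If A is semiprimary,
    the image of I in A/J has an idempotent left identity, which lifts to an
    idempotent e of I with i - e i in J for all i in I.  On a module with
    X e = 0, elements of I then act like elements of J, so X is annihilated by
    a power of I. *)
From HB Require Import structures.
From mathcomp Require Import all_boot all_algebra.
From mathcomp Require Import boolp.
From mathcomp.multinomials Require Import freeg.
Require Import Defs.

Set Implicit Arguments.
Unset Strict Implicit.
Unset Printing Implicit Defensive.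

Import GRing.Theory.
Local Open Scope ring_scope.

(** * Adjunctions and equivalences of preadditive categories *)

Lemma comp0l (C : preadditive) (X Y Z : C) (f : mor X Y) :
  (0 : mor Y Z) \oc f = 0.
Proof. by apply: (addIr (0 \oc f)); rewrite add0r -compDl addr0. Qed.

Lemma comp0r (C : preadditive) (X Y Z : C) (g : mor Y Z) :
  g \oc (0 : mor X Y) = 0.
Proof. by apply: (addIr (g \oc 0)); rewrite add0r -compDr addr0. Qed.

Lemma compBr (C : preadditive) (X Y Z : C) (g : mor Y Z) (f f' : mor X Y) :
  g \oc (f - f') = g \oc f - g \oc f'.
Proof. by apply: (addIr (g \oc f')); rewrite -compDr !subrK. Qed.

Lemma compBl (C : preadditive) (X Y Z : C) (g g' : mor Y Z) (f : mor X Y) :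
  (g - g') \oc f = g \oc f - g' \oc f.
Proof. by apply: (addIr (g' \oc f)); rewrite -compDl !subrK. Qed.

Lemma additive0 (C D : preadditive) (F : functor C D) (X Y : C) :
  additive_functor F -> fhom F (0 : mor X Y) = 0.
Proof. by move=> aF; apply: (addIr (fhom F 0)); rewrite add0r -aF addr0. Qed.

Lemma zero_objectP (C : preadditive) (Z : C) : is_zero_object Z <-> idm Z = 0.
Proof.
split=> [[+ _]|z]; first exact.
split=> X f g; first by rewrite -[f]comp_idl -[g]comp_idl z !comp0l.
by rewrite -[f]comp_idr -[g]comp_idr z !comp0r.
Qed.

Lemma is_iso_idm (C : preadditive) (X : C) : is_iso (idm X).
Proof. by exists (idm X); rewrite comp_idl. Qed.

Lemma is_iso_comp (C : preadditive) (X Y Z : C) (g : mor Y Z) (f : mor X Y) :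
  is_iso g -> is_iso f -> is_iso (g \oc f).
Proof.
move=> [g' [gK gK']] [f' [fK fK']]; exists (f' \oc g'); split.
  by rewrite comp_assoc -(comp_assoc f') gK comp_idr.
by rewrite comp_assoc -(comp_assoc g) fK' comp_idr.
Qed.

Lemma is_iso_fhom (C D : preadditive) (F : functor C D) (X Y : C)
  (f : mor X Y) : is_iso f -> is_iso (fhom F f).
Proof.
by move=> [g [gK fK]]; exists (fhom F g); rewrite -!fhom_comp gK fK !fhom_id.
Qed.

Lemma is_zero_object_iso (C : preadditive) (X Y : C) (f : mor X Y) :
  is_iso f -> is_zero_object X <-> is_zero_object Y.
Proof.
move=> [g [gK fK]]; split=> /zero_objectP z; apply/zero_objectP.
  by rewrite -fK -[f]comp_idr z comp0r comp0l.
by rewrite -gK -[g]comp_idr z comp0r comp0l.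
Qed.

Lemma in_ker_iso (C D : preadditive) (F : functor C D) (X Y : C) (f : mor X Y) :
  is_iso f -> in_ker F X <-> in_ker F Y.
Proof. by move=> fI; apply: is_zero_object_iso (is_iso_fhom F fI). Qed.

Lemma nat_iso_refl (C D : preadditive) (F : functor C D) : nat_iso F F.
Proof.
exists (fun X => idm (F X)); split=> [X Y f|X]; last exact: is_iso_idm.
by rewrite comp_idl comp_idr.
Qed.

Lemma nat_iso_sym (C D : preadditive) (F G : functor C D) :
  nat_iso F G -> nat_iso G F.
Proof.
move=> [t [tN tI]]; exists (fun X => sval (cid (tI X))); split=> [X Y f|X].
  case: (cid (tI X)) => u /= [uK Ku]; case: (cid (tI Y)) => v /= [vK Kv].
  by rewrite -[LHS]comp_idr -Ku comp_assoc -(comp_assoc v) -tN comp_assoc vK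
    comp_idl.
by case: (cid (tI X)) => u /= [uK Ku]; exists (t X).
Qed.

Lemma nat_iso_trans (C D : preadditive) (F G H : functor C D) :
  nat_iso F G -> nat_iso G H -> nat_iso F H.
Proof.
move=> [t [tN tI]] [u [uN uI]]; exists (fun X => u X \oc t X).
split=> [X Y f|X]; last exact: is_iso_comp.
by rewrite -comp_assoc tN comp_assoc uN comp_assoc.
Qed.

Lemma nat_iso_compl (C D E : preadditive) (G : functor D E)
  (F F' : functor C D) : nat_iso F F' -> nat_iso (fcomp G F) (fcomp G F').
Proof.
move=> [t [tN tI]]; exists (fun X => fhom G (t X)); split=> [X Y f|X].
  by rewrite /= -!fhom_comp tN.
exact: is_iso_fhom G _ _ _ (tI X).
Qed.

Lemma nat_iso_compr (C D E : preadditive) (G G' : functor D E)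
  (F : functor C D) : nat_iso G G' -> nat_iso (fcomp G F) (fcomp G' F).
Proof.
by move=> [t [tN tI]]; exists (fun X => t (F X)); split=> [X Y f|X] //=.
Qed.

(** [adjoint] only asserts that some natural bijection of hom groups exists. The arguments below are
    equational and run on naturality and the triangle identities, so an adjunction is unpacked into
    this form. *)
Definition unit_counit (C D : preadditive) (F : functor C D) (G : functor D C)
    (eta : forall X, mor X (G (F X))) (eps : forall Y, mor (F (G Y)) Y) :
    Prop :=
  [/\ forall X Y (f : mor X Y), fhom G (fhom F f) \oc eta X = eta Y \oc f,
      forall X Y (f : mor X Y), eps Y \oc fhom F (fhom G f) = f \oc eps X,
      forall X, eps (F X) \oc fhom F (eta X) = idm (F X)
    & forall Y, fhom G (eps Y) \oc eta (G Y) = idm (G Y)].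

Lemma unit_counit_adjoint (C D : preadditive) (F : functor C D)
    (G : functor D C) eta eps :
  @unit_counit C D F G eta eps -> adjoint F G.
Proof.
move=> [etaN epsN tF tG]; exists (fun X Y f => fhom G f \oc eta X); split.
  move=> X Y; exists (fun g => eps Y \oc fhom F g) => [f|g].
    by rewrite fhom_comp comp_assoc epsN -comp_assoc tF comp_idr.
  by rewrite fhom_comp -comp_assoc etaN comp_assoc tG comp_idl.
by move=> X X' Y Y' u v f; rewrite !fhom_comp -!comp_assoc etaN.
Qed.

(** The unit and counit are the transposes of identities. Naturality of [phi] in each variable
    separately, [phiE] and [phiE'], reduces every identity to a comparison of transposes. *)
Lemma adjoint_unit_counit (C D : preadditive) (F : functor C D)
    (G : functor D C) :
  adjoint F G -> exists eta eps, @unit_counit C D F G eta eps.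
Proof.
move=> [phi [phiB phiN]].
have psiP X Y : exists psi : mor X (G Y) -> mor (F X) Y,
    cancel (phi X Y) psi /\ cancel psi (phi X Y).
  by case: (phiB X Y) => psi; exists psi.
pose psi X Y := sval (cid (psiP X Y)).
have phiK X Y : cancel (phi X Y) (psi X Y) by case: (svalP (cid (psiP X Y))).
have psiK X Y : cancel (psi X Y) (phi X Y) by case: (svalP (cid (psiP X Y))).
have phiE X Y f : phi X Y f = fhom G f \oc phi X (F X) (idm _).
  have := phiN _ _ _ _ (idm X) f (idm _).
  by rewrite fhom_id !comp_idr.
have phiE' X X' Y (u : mor X' X) (f : mor (F X) Y) :
    phi X' Y (f \oc fhom F u) = phi X Y f \oc u.
  by have := phiN _ _ _ _ u (idm Y) f; rewrite fhom_id !comp_idl.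
exists (fun X => phi X (F X) (idm _)), (fun Y => psi (G Y) Y (idm _)).
split=> [X Y f|X Y f|X|Y].
- by rewrite -phiE -[fhom F f]comp_idl phiE'.
- apply: (can_inj (phiK _ _)); rewrite phiE' psiK comp_idl.
  by rewrite phiE fhom_comp -comp_assoc -phiE psiK comp_idr.
- by apply: (can_inj (phiK _ _)); rewrite phiE' psiK comp_idl.
- by rewrite -phiE psiK.
Qed.

Lemma adjoint_comp (C D E : preadditive) (F : functor C D) (G : functor D C)
    (F' : functor D E) (G' : functor E D) :
  adjoint F G -> adjoint F' G' -> adjoint (fcomp F' F) (fcomp G G').
Proof.
move=> [phi [phiB phiN]] [phi' [phi'B phi'N]].
exists (fun X Y f => phi X (G' Y) (phi' (F X) Y f)); split=> [X Y|*].
  exact: bij_comp (phiB _ _) (phi'B _ _).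
by rewrite /= phi'N phiN.
Qed.

Lemma adjoint_nat_iso_r (C D : preadditive) (F : functor C D)
    (G G' : functor D C) :
  nat_iso G G' -> adjoint F G -> adjoint F G'.
Proof.
move=> [t [tN tI]] [phi [phiB phiN]].
exists (fun X Y f => t Y \oc phi X Y f); split=> [X Y|X X' Y Y' u v f].
  have [t' [tK Kt]] := tI Y.
  apply: (bij_comp (f := comp (t Y))) (phiB _ _).
  by exists (comp t') => f; rewrite comp_assoc ?tK ?Kt comp_idl.
by rewrite phiN !comp_assoc tN.
Qed.

Lemma is_equivalence_faithful (C D : preadditive) (F : functor C D)
    (G : functor D C) (X Y : C) (f g : mor X Y) :
  nat_iso (fcomp G F) (fid C) -> fhom F f = fhom F g -> f = g.
Proof.
move=> [t [tN tI]] fg; have [t' [_ tK]] := tI X.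
by rewrite -[f]comp_idr -[g]comp_idr -tK !comp_assoc -!tN /= fg.
Qed.

Lemma is_equivalence_ff (C D : preadditive) (F : functor C D)
    (G : functor D C) :
  nat_iso (fcomp G F) (fid C) -> nat_iso (fcomp F G) (fid D) ->
  fully_faithful F.
Proof.
move=> GF FG X Y; have [t [tN tI]] := GF; have [t' [tK Kt]] := tI X.
exists (fun h => t Y \oc fhom G h \oc t') => [f|h].
  by rewrite tN -comp_assoc Kt comp_idr.
(* The candidate preimage of [h] is [fhom G h] conjugated by [t]. That [F] maps it to [h] is tested
   after applying [G], which is faithful by [FG]. *)
apply: (is_equivalence_faithful FG).
have [u [uK Ku]] := tI Y.
have /= := tN _ _ (t Y \oc fhom G h \oc t'); move/(congr1 (comp u)).
by rewrite -!comp_assoc tK comp_idr !comp_assoc uK !comp_idl.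
Qed.

(** The transpose of [f] is [fhom G f] precomposed with the isomorphism [t X] from [X] to [G (F X)];
    it is bijective in [f] because [G] is fully faithful. *)
Lemma is_equivalence_adjoint (C D : preadditive) (F : functor C D)
    (G : functor D C) :
  nat_iso (fcomp G F) (fid C) -> nat_iso (fcomp F G) (fid D) -> adjoint F G.
Proof.
move=> GF FG; have ffG := is_equivalence_ff FG GF.
have [t [tN tI]] := nat_iso_sym GF.
exists (fun X Y f => fhom G f \oc t X); split=> [X Y|X X' Y Y' u v f].
  have [t' [tK Kt]] := tI X.
  apply: (bij_comp (f := fun g => g \oc t X)) (ffG _ _).
  by exists (fun g => g \oc t') => g; rewrite -comp_assoc ?tK ?Kt comp_idr.
by rewrite !fhom_comp -!comp_assoc -tN.
Qed.

Lemma is_equivalence_sym (C D : preadditive) (F : functor C D)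
    (G : functor D C) :
  nat_iso (fcomp G F) (fid C) -> nat_iso (fcomp F G) (fid D) ->
  is_equivalence G.
Proof. by move=> GF FG; exists F. Qed.

Lemma fid_is_equivalence (C : preadditive) : is_equivalence (fid C).
Proof. by exists (fid C); split; apply: nat_iso_refl. Qed.

(* The functor preserves the product (p1, p2), and h = f p1 + g p2 satisfies
   h (1, 1) = f + g. *)
Lemma is_equivalence_additive (C D : preadditive) (F : functor C D) :
  (forall X Y : C, exists P : C, is_biproduct X Y P) ->
  (exists Z : C, is_zero_object Z) -> is_equivalence F -> additive_functor F.
Proof.
move=> bC [Z0 Z0z] [G [GF FG]]; have ffF := is_equivalence_ff GF FG.
have ffG := is_equivalence_ff FG GF.
have FZ0 : is_zero_object (F Z0).
  have FidK : forall W (f g : mor W (F Z0)), f = g.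
    move=> W f g; apply: (is_equivalence_faithful FG).
    have [t [_ tI]] := GF; have [t' [tK _]] := tI Z0.
    rewrite -[fhom G f]comp_idl -[fhom G g]comp_idl -tK -!comp_assoc.
    by congr (t' \oc _); apply: Z0z.1.
  by apply/zero_objectP; apply: FidK.
have F0 X Y : fhom F (0 : mor X Y) = 0.
  rewrite -(comp0l Y (0 : mor X Z0)) fhom_comp.
  by rewrite (FZ0.2 _ (fhom F (0 : mor Z0 Y)) 0) comp0l.
move=> X Y f g.
have [P [i1 [i2 [p1 [p2 [p1i1 p2i2 p1i2 p2i1 idP]]]]]] := bC X X.
(* The images of the projections are jointly monic: up to the isomorphism from [F (G W)] to [W], a
   map into [F P] is the image under [F] of a map into [P], which [p1] and [p2] determine. *)
have joint W (a b : mor W (F P)) : fhom F p1 \oc a = fhom F p1 \oc b ->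
    fhom F p2 \oc a = fhom F p2 \oc b -> a = b.
  move=> ab1 ab2; have [t [_ tI]] := FG; have [t' [_ tK]] := tI W.
  have [h _ Kh] := ffF (G W) P.
  suff ab : a \oc t W = b \oc t W.
    by rewrite -[a]comp_idr -[b]comp_idr -tK !comp_assoc ab.
  rewrite -(Kh (a \oc t W)) -(Kh (b \oc t W)); congr (fhom F _).
  have ff := is_equivalence_faithful GF.
  have e1 : p1 \oc h (a \oc t W) = p1 \oc h (b \oc t W).
    by apply: ff; rewrite !fhom_comp !Kh !comp_assoc ab1.
  have e2 : p2 \oc h (a \oc t W) = p2 \oc h (b \oc t W).
    by apply: ff; rewrite !fhom_comp !Kh !comp_assoc ab2.
  rewrite -[h (a \oc _)]comp_idl -[h (b \oc _)]comp_idl -idP !compDl.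
  by rewrite -!comp_assoc e1 e2.
have FidP : fhom F i1 \oc fhom F p1 + fhom F i2 \oc fhom F p2 = idm (F P).
  apply: joint; rewrite compDr !comp_assoc -!fhom_comp ?p1i1 ?p2i2 ?p1i2 ?p2i1.
    by rewrite comp0l F0 addr0 comp_idl comp_idr.
  by rewrite comp0l F0 add0r comp_idl comp_idr.
pose h := f \oc p1 + g \oc p2; pose d := i1 + i2.
have hi1 : h \oc i1 = f.
  by rewrite compDl -!comp_assoc p1i1 p2i1 comp0r addr0 comp_idr.
have hi2 : h \oc i2 = g.
  by rewrite compDl -!comp_assoc p2i2 p1i2 comp0r add0r comp_idr.
have p1d : p1 \oc d = idm X by rewrite compDr p1i1 p1i2 addr0.
have p2d : p2 \oc d = idm X by rewrite compDr p2i1 p2i2 add0r.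
have -> : f + g = h \oc d by rewrite compDr hi1 hi2.
rewrite fhom_comp -[fhom F h]comp_idr -FidP compDr compDl !comp_assoc.
by rewrite -!fhom_comp hi1 hi2 -!comp_assoc p1d p2d !comp_idr.
Qed.

(** * Kernels and cokernels under functors with adjoints *)

Lemma is_kernel_mono (C : preadditive) (K X Y : C) (k : mor K X) (f : mor X Y) :
  is_kernel k f -> mono k.
Proof.
move=> [fk kU] W u v kuv; have [|w [_ wU]] := kU W (k \oc u).
  by rewrite comp_assoc fk comp0l.
by rewrite -(wU u) // -(wU v).
Qed.

Lemma is_cokernel_epi (C : preadditive) (X Y Q : C) (q : mor Y Q)
  (f : mor X Y) : is_cokernel q f -> epi q.
Proof.
move=> [qf qU] W u v uvq; have [|w [_ wU]] := qU W (u \oc q).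
  by rewrite -comp_assoc qf comp0r.
by rewrite -(wU u) // -(wU v).
Qed.

(** A mono [f] is a kernel of some [g]. If [f] is also epi then [g = 0], so the identity of [Y]
    factors through [f]. *)
Lemma mono_epi_iso (C : preadditive) (X Y : C) (f : mor X Y) :
  is_abelian C -> mono f -> epi f -> is_iso f.
Proof.
move=> aC mf ef; have [Z [g [gf fU]]] := ab_mono aC mf.
have g0 : g = 0 by apply: ef; rewrite gf comp0l.
have [|u [uf _]] := fU _ (idm Y); first by rewrite g0 comp0l.
exists u; split=> //; apply: mf.
by rewrite comp_assoc uf comp_idl comp_idr.
Qed.

Lemma right_adjoint_mono (C D : preadditive) (F : functor C D)
    (G : functor D C) (X Y : D) (f : mor X Y) :
  adjoint F G -> mono f -> mono (fhom G f).
Proof.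
move=> /adjoint_unit_counit [eta [eps [etaN epsN _ tG]]] mf W u v uv.
have trans (w : mor W (G X)) : w = fhom G (eps X \oc fhom F w) \oc eta W.
  by rewrite fhom_comp -comp_assoc etaN comp_assoc tG comp_idl.
rewrite (trans u) (trans v); congr (fhom G _ \oc _); apply: mf.
by rewrite !comp_assoc -!epsN -!comp_assoc -!fhom_comp uv.
Qed.

Lemma left_adjoint_epi (C D : preadditive) (F : functor C D)
    (G : functor D C) (X Y : C) (f : mor X Y) :
  adjoint F G -> epi f -> epi (fhom F f).
Proof.
move=> /adjoint_unit_counit [eta [eps [etaN epsN tF _]]] ef W u v uv.
have trans (w : mor (F Y) W) : w = eps W \oc fhom F (fhom G w \oc eta Y).
  by rewrite fhom_comp comp_assoc epsN -comp_assoc tF comp_idr.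
rewrite (trans u) (trans v); congr (_ \oc fhom F _); apply: ef.
by rewrite -!comp_assoc -!etaN !comp_assoc -!fhom_comp uv.
Qed.

(** A map [g] killed by [fhom G f] is transposed to a map out of [F W] killed by [f], factored
    through [k], and transposed back. Additivity keeps zero morphisms zero along the way. *)
Lemma right_adjoint_kernel (C D : preadditive) (F : functor C D)
    (G : functor D C) (K X Y : D) (k : mor K X) (f : mor X Y) :
  adjoint F G -> additive_functor F -> additive_functor G ->
  is_kernel k f -> is_kernel (fhom G k) (fhom G f).
Proof.
move=> adj aF aG kf; have := right_adjoint_mono adj (is_kernel_mono kf).
have [fk kU] := kf => mGk; split; first by rewrite -fhom_comp fk additive0.
move=> W g fg; have [eta [eps [etaN epsN tF tG]]] := adjoint_unit_counit adj.
have [|u [ku _]] := kU (F W) (eps X \oc fhom F g).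
  by rewrite comp_assoc -epsN -comp_assoc -fhom_comp fg additive0 ?comp0r.
have kug : fhom G k \oc (fhom G u \oc eta W) = g.
  rewrite comp_assoc -fhom_comp ku fhom_comp -comp_assoc etaN comp_assoc.
  by rewrite tG comp_idl.
by exists (fhom G u \oc eta W); split=> // u' ku'; apply: mGk; rewrite ku'.
Qed.

Lemma left_adjoint_cokernel (C D : preadditive) (F : functor C D)
    (G : functor D C) (X Y Q : C) (q : mor Y Q) (f : mor X Y) :
  adjoint F G -> additive_functor F -> additive_functor G ->
  is_cokernel q f -> is_cokernel (fhom F q) (fhom F f).
Proof.
move=> adj aF aG qf; have := left_adjoint_epi adj (is_cokernel_epi qf).
have [fq qU] := qf => eFq; split; first by rewrite -fhom_comp fq additive0.
move=> W g gf; have [eta [eps [etaN epsN tF tG]]] := adjoint_unit_counit adj.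
have [|u [uq _]] := qU (G W) (fhom G g \oc eta Y).
  by rewrite -comp_assoc -etaN comp_assoc -fhom_comp gf additive0 ?comp0l.
have ugq : (eps W \oc fhom F u) \oc fhom F q = g.
  rewrite -comp_assoc -fhom_comp uq fhom_comp comp_assoc epsN -comp_assoc.
  by rewrite tF comp_idr.
by exists (eps W \oc fhom F u); split=> // u' uq'; apply: eFq; rewrite uq'.
Qed.

Lemma kernel_iso_zero (C : preadditive) (K X Y : C) (k : mor K X)
  (f : mor X Y) : is_kernel k f -> is_iso f -> is_zero_object K.
Proof.
move=> kf [g [gf _]]; apply/zero_objectP; apply: (is_kernel_mono kf).
rewrite comp0r comp_idr -[k]comp_idl -gf -comp_assoc; case: kf => -> _.
by rewrite comp0r.
Qed.

Lemma cokernel_iso_zero (C : preadditive) (X Y Q : C) (q : mor Y Q)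
  (f : mor X Y) : is_cokernel q f -> is_iso f -> is_zero_object Q.
Proof.
move=> qf [g [_ fg]]; apply/zero_objectP; apply: (is_cokernel_epi qf).
rewrite comp0l comp_idl -[q]comp_idr -fg comp_assoc; case: qf => -> _.
by rewrite comp0l.
Qed.

Lemma kernel_zero_mono (C : preadditive) (K X Y : C) (k : mor K X)
  (f : mor X Y) : is_kernel k f -> is_zero_object K -> mono f.
Proof.
move=> [_ kU] [K0 _] W u v fuv; apply/eqP; rewrite -subr_eq0; apply/eqP.
have [|w [<- _]] := kU W (u - v); first by rewrite compBr fuv subrr.
by rewrite (K0 _ w 0) comp0r.
Qed.

Lemma cokernel_zero_epi (C : preadditive) (X Y Q : C) (q : mor Y Q)
  (f : mor X Y) : is_cokernel q f -> is_zero_object Q -> epi f.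
Proof.
move=> [_ qU] [_ Q0] W u v uvf; apply/eqP; rewrite -subr_eq0; apply/eqP.
have [|w [<- _]] := qU W (u - v); first by rewrite compBl uvf subrr.
by rewrite (Q0 _ w 0) comp0l.
Qed.

(** As a right adjoint of [l], [j] preserves the kernel [k]; as a left adjoint of [r], it preserves
    the cokernel [q]. In the abelian category [C], a map with zero kernel and zero cokernel is
    invertible. *)
Lemma inverts_iff (A C : preadditive) (l r : functor C A) (j : functor A C)
    (X Y K Q : A) (f : mor X Y) (k : mor K X) (q : mor Y Q) :
  is_abelian C -> adjoint l j -> adjoint j r ->
  additive_functor l -> additive_functor j -> additive_functor r ->
  is_kernel k f -> is_cokernel q f ->
  is_iso (fhom j f) <-> in_ker j K /\ in_ker j Q.
Proof.
move=> aC lj jr al aj ar kf qf.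
have jk := right_adjoint_kernel lj al aj kf.
have jq := left_adjoint_cokernel jr aj ar qf.
split=> [jf|[jK jQ]].
  by split; [apply: kernel_iso_zero jk jf | apply: cokernel_iso_zero jq jf].
apply: mono_epi_iso => //; first exact: kernel_zero_mono jk jK.
exact: cokernel_zero_epi jq jQ.
Qed.

(** * Fully faithful adjoints *)

(** The inverse is the preimage under [G] of the unit at [G Y]. One composite is a triangle identity
    read through [G]; the other is naturality of the counit followed by the other triangle
    identity. *)
Lemma right_adjoint_ff_counit (C D : preadditive) (F : functor C D)
    (G : functor D C) eta eps Y :
  @unit_counit C D F G eta eps -> fully_faithful G -> is_iso (eps Y).
Proof.
move=> [etaN epsN tF tG] ffG; have [h hK Kh] := ffG Y (F (G Y)).
exists (h (eta (G Y))).
have e : eps Y \oc h (eta (G Y)) = idm Y.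
  have [h' h'K _] := ffG Y Y; apply: (can_inj h'K).
  by rewrite fhom_comp Kh tG fhom_id.
split=> //.
by rewrite -epsN Kh tF.
Qed.

Lemma counit_iso_right_adjoint_ff (C D : preadditive) (F : functor C D)
    (G : functor D C) eta eps :
  @unit_counit C D F G eta eps -> (forall Y, is_iso (eps Y)) ->
  fully_faithful G.
Proof.
move=> [etaN epsN tF tG] eI X Y; have [e [eK Ke]] := eI X.
exists (fun g => eps Y \oc fhom F g \oc e) => [f|g].
  by rewrite epsN -comp_assoc Ke comp_idr.
have Ge : fhom G e = eta (G X).
  by rewrite -[LHS]comp_idr -tG comp_assoc -fhom_comp eK fhom_id comp_idl.
by rewrite !fhom_comp Ge -comp_assoc etaN comp_assoc tG comp_idl.
Qed.

Lemma unit_iso_left_adjoint_ff (C D : preadditive) (F : functor C D)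
    (G : functor D C) eta eps :
  @unit_counit C D F G eta eps -> (forall X, is_iso (eta X)) ->
  fully_faithful F.
Proof.
move=> [etaN epsN tF tG] eI X Y; have [e [eK Ke]] := eI Y.
exists (fun g => e \oc fhom G g \oc eta X) => [f|g].
  by rewrite -comp_assoc etaN comp_assoc eK comp_idl.
have Fe : fhom F e = eps (F Y).
  by rewrite -[LHS]comp_idl -tF -comp_assoc -fhom_comp Ke fhom_id comp_idr.
by rewrite !fhom_comp Fe epsN -comp_assoc tF comp_idr.
Qed.

(* For F -| G -| H with H fully faithful, precomposition with the unit
   Y -> G F Y is the composite Hom(G F Y, N) = Hom(F Y, H N) = Hom(Y, G H N)
   = Hom(Y, N), so the unit is invertible by Yoneda. *)
Lemma adjoint_triple_ff (C D : preadditive) (F H : functor C D)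
    (G : functor D C) :
  adjoint F G -> adjoint G H -> fully_faithful H -> fully_faithful F.
Proof.
move=> FG GH ffH; have [eta [eps FGuc]] := adjoint_unit_counit FG.
have [eta' [eps' GHuc]] := adjoint_unit_counit GH.
apply: (unit_iso_left_adjoint_ff FGuc) => X.
have epsI N := right_adjoint_ff_counit N GHuc ffH.
have [etaN epsN tF tG] := FGuc; have [eta'N eps'N tF' tG'] := GHuc.
have inj N (v w : mor (G (F X)) N) : v \oc eta X = w \oc eta X -> v = w.
  have trans (v' : mor (G (F X)) N) :
      v' = eps' N \oc fhom G (fhom H v' \oc eta' (F X)).
    by rewrite fhom_comp comp_assoc eps'N -comp_assoc tF' comp_idr.
  move=> vw; rewrite (trans v) (trans w); congr (_ \oc fhom G _).
  have [e [eK Ke]] := epsI N.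
  (* The bracket is the image of [u] in the maps from [X] to [N]; undoing [eps' N] and transposing
     back along [F], [G] recovers [u]. *)
  have trans' (u : mor (F X) (H N)) :
      u = eps (H N) \oc fhom F (e \oc (eps' N \oc fhom G u \oc eta X)).
    rewrite -(comp_assoc (eps' N)) (comp_assoc e) eK comp_idl.
    by rewrite fhom_comp comp_assoc epsN -comp_assoc tF comp_idr.
  rewrite (trans' (fhom H v \oc _)) (trans' (fhom H w \oc _)).
  by rewrite -(trans v) -(trans w) vw.
have [e [eK Ke]] := epsI X.
(* [u] is the transpose of [e], the inverse of [eps' X]. Hence [eps' X \oc fhom G u] is a retraction
   of the unit, and [inj] makes it a two-sided inverse. *)
pose u := eps (H X) \oc fhom F e.
have uE : fhom G u \oc eta X = e.
  by rewrite fhom_comp -comp_assoc etaN comp_assoc tG comp_idl.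
exists (eps' X \oc fhom G u).
have uK : eps' X \oc fhom G u \oc eta X = idm X by rewrite -comp_assoc uE Ke.
split=> //; apply: inj.
by rewrite -comp_assoc uK comp_idl comp_idr.
Qed.

(** * Recollements with matching kernels *)

Lemma additive_fcomp (C D E : preadditive) (G : functor D E) (F : functor C D) :
  additive_functor G -> additive_functor F -> additive_functor (fcomp G F).
Proof. by move=> aG aF X Y f g; rewrite /= aF aG. Qed.

Lemma right_adjoint_ff_nat_iso (C D : preadditive) (F : functor C D)
    (G : functor D C) :
  adjoint F G -> fully_faithful G -> nat_iso (fcomp F G) (fid D).
Proof.
move=> /adjoint_unit_counit [eta [eps uc]] ffG; exists eps; split.
  by case: uc => _ + _ _; apply.
by move=> Y; apply: right_adjoint_ff_counit uc ffG.
Qed.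

(** By a triangle identity [j^*] sends the unit at [X] to the inverse of a counit, which is
    invertible because [j_*] is fully faithful. So the kernel and cokernel of the unit lie in the
    kernel of [j^*], and by [ker] the functor [j'^* Phi] kills them too. *)
Lemma recollement_unit_nat_iso (B A C B' A' C' : preadditive)
    (R : recollement B A C) (R' : recollement B' A' C')
    (Phi : functor A A') (Psi : functor A' A) :
  nat_iso (fcomp Psi Phi) (fid A) -> nat_iso (fcomp Phi Psi) (fid A') ->
  (forall X, in_ker (j_upper_star R) X -> in_ker (j_upper_star R') (Phi X)) ->
  nat_iso (fcomp (j_upper_star R') Phi)
    (fcomp (fcomp (j_upper_star R') Phi)
       (fcomp (j_lower_star R) (j_upper_star R))).
Proof.
move=> PsiPhi PhiPsi ker.
have [aB aA aC] := rec_abelian R; have [aB' aA' aC'] := rec_abelian R'.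
have [aj al ar] := rec_additive_j R; have [aj' al' ar'] := rec_additive_j R'.
have [lj jr] := rec_adjoint_j R; have [lj' jr'] := rec_adjoint_j R'.
have [_ _ ffr] := rec_ff R.
have PhiE : is_equivalence Phi by exists Psi.
have aPhi := is_equivalence_additive (ab_biproduct aA) (ab_zero aA) PhiE.
have aPsi := is_equivalence_additive (ab_biproduct aA') (ab_zero aA')
  (is_equivalence_sym PsiPhi PhiPsi).
have [eta [eps uc]] := adjoint_unit_counit jr.
have [etaN epsN tF _] := uc.
exists (fun X => fhom (j_upper_star R') (fhom Phi (eta X))); split.
  by move=> X Y f /=; rewrite -!fhom_comp etaN.
move=> X; have [K [k kf]] := ab_kernel aA (eta X).
have [Q [q qf]] := ab_cokernel aA (eta X).
have jeta : is_iso (fhom (j_upper_star R) (eta X)).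
  have [e [eK Ke]] := right_adjoint_ff_counit (j_upper_star R X) uc ffr.
  have -> : fhom (j_upper_star R) (eta X) = e.
    by rewrite -[LHS]comp_idl -eK -comp_assoc tF comp_idr.
  by exists (eps (j_upper_star R X)).
have /(_ jeta) [jK jQ] := (inverts_iff aC lj jr al aj ar kf qf).1.
(* [j'^* Phi] has the left adjoint [Psi j'_!] and the right adjoint [Psi j'_*], so [inverts_iff]
   applies to it. *)
have adj1 := adjoint_comp lj' (is_equivalence_adjoint PhiPsi PsiPhi).
have adj2 := adjoint_comp (is_equivalence_adjoint PsiPhi PhiPsi) jr'.
apply: (inverts_iff aC' adj1 adj2 _ _ _ kf qf).2.
- exact: additive_fcomp.
- exact: additive_fcomp.
- exact: additive_fcomp.
- by split; apply: ker.
Qed.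

Lemma recollement_equiv_of_ker (B A C B' A' C' : preadditive)
    (R : recollement B A C) (R' : recollement B' A' C')
    (Phi : functor A A') :
  is_equivalence Phi ->
  (forall X, in_ker (j_upper_star R) X <-> in_ker (j_upper_star R') (Phi X)) ->
  recollement_equiv R R'.
Proof.
move=> PhiE ker; have [Psi [PsiPhi PhiPsi]] := PhiE.
have ker' Y : in_ker (j_upper_star R') Y -> in_ker (j_upper_star R) (Psi Y).
  have [t [_ tI]] := PhiPsi.
  by move=> /(in_ker_iso (j_upper_star R') (tI Y)) /ker.
have kerR X : in_ker (j_upper_star R) X -> in_ker (j_upper_star R') (Phi X).
  by move/ker.
have N1 := recollement_unit_nat_iso PsiPhi PhiPsi kerR.
have N2 := recollement_unit_nat_iso PhiPsi PsiPhi ker'.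
have [_ jr] := rec_adjoint_j R; have [_ jr'] := rec_adjoint_j R'.
have [_ _ ffr] := rec_ff R; have [_ _ ffr'] := rec_ff R'.
have E1 := right_adjoint_ff_nat_iso jr ffr.
have E2 := right_adjoint_ff_nat_iso jr' ffr'.
exists Phi, (fcomp (j_upper_star R') (fcomp Phi (j_lower_star R))).
split=> //; last exact: nat_iso_sym N1.
(* In [j^* Psi j'_* j'^* Phi j_*] the inner [j'_* j'^*] is removed by [N2], then [Psi Phi] by
   [PsiPhi], and [j^* j_*] by the counit. The other composite is symmetric. *)
exists (fcomp (j_upper_star R) (fcomp Psi (j_lower_star R'))); split.
  apply: nat_iso_trans E1.
  apply: nat_iso_trans (nat_iso_compl (j_upper_star R)
    (nat_iso_compr (j_lower_star R) PsiPhi)).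
  exact: nat_iso_sym (nat_iso_compr (fcomp Phi (j_lower_star R)) N2).
apply: nat_iso_trans E2.
apply: nat_iso_trans (nat_iso_compl (j_upper_star R')
  (nat_iso_compr (j_lower_star R') PhiPsi)).
exact: nat_iso_sym (nat_iso_compr (fcomp Psi (j_lower_star R')) N1).
Qed.

(** * Submodules, quotients and the abelian category Mod-R *)

(** Bundling a boolean predicate with its closure proof lets the library structures of submodule and
    quotient attach to it; [to_submod] brings in the [Prop]-valued submodules through [asbool]. *)
Record submod (R : pzRingType) (M : lmodType R) := Submod {
  submod_pred :> {pred M};
  submod_closed : GRing.submod_closed submod_pred
}.

HB.instance Definition _ (R : pzRingType) (M : lmodType R) (N : submod M) :=
  GRing.isSubmodClosed.Build R M (submod_pred N)
    (GRing.submod_closed_semi (submod_closed N)).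

Lemma submodule_closed (R : pzRingType) (M : lmodType R) (N : M -> Prop) :
  submodule N -> GRing.submod_closed (fun x => `[< N x >]).
Proof.
move=> [N0 ND NZ]; split; first exact/asboolP.
by move=> a x y /asboolP Nx /asboolP Ny; apply/asboolP/ND => //; apply: NZ.
Qed.

Definition to_submod (R : pzRingType) (M : lmodType R) (N : M -> Prop)
  (sN : submodule N) : submod M := Submod (submodule_closed sN).

Record sub_module (R : pzRingType) (M : lmodType R) (N : submod M) :=
  SubElt { sub_val :> M; subP : sub_val \in submod_pred N }.
HB.instance Definition _ (R : pzRingType) (M : lmodType R) (N : submod M) :=
  [isSub for @sub_val R M N].
HB.instance Definition _ (R : pzRingType) (M : lmodType R) (N : submod M) :=
  [Choice of sub_module N by <:].
HB.instance Definition _ (R : pzRingType) (M : lmodType R) (N : submod M) :=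
  [SubChoice_isSubLmodule of sub_module N by <:].

Definition sub_inj (R : pzRingType) (M : lmodType R) (N : submod M)
  (x : sub_module N) : M := val x.
HB.instance Definition _ (R : pzRingType) (M : lmodType R) (N : submod M) :=
  GRing.Linear.copy (@sub_inj R M N) (val : sub_module N -> M).

Definition quo_module (R : pzRingType) (M : lmodType R) (N : submod M) : Type :=
  Quotient.quot (submod_pred N).
HB.instance Definition _ (R : pzRingType) (M : lmodType R) (N : submod M) :=
  GRing.Zmodule.on (quo_module N).

Definition quo_pi (R : pzRingType) (M : lmodType R) (N : submod M) (x : M) :
  quo_module N := \pi_(Quotient.quot (submod_pred N))%qT x.

Lemma quo_pi_surj (R : pzRingType) (M : lmodType R) (N : submod M)
  (u : quo_module N) : exists x, u = quo_pi N x.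
Proof.
exists (repr (u : Quotient.quot (submod_pred N))).
exact/esym/(@reprK _ (Quotient.quot (submod_pred N))).
Qed.

Lemma quo_pi_eq (R : pzRingType) (M : lmodType R) (N : submod M) (x y : M) :
  quo_pi N x = quo_pi N y <-> x - y \in submod_pred N.
Proof.
rewrite /quo_pi; split; first by move=> /eqP; rewrite -Quotient.idealrBE.
by move=> xy; apply/eqP; rewrite -Quotient.idealrBE.
Qed.

Lemma quo_pi_is_additive (R : pzRingType) (M : lmodType R) (N : submod M) :
  zmod_morphism (@quo_pi R M N).
Proof. by move=> u v; rewrite /quo_pi raddfB. Qed.
HB.instance Definition _ (R : pzRingType) (M : lmodType R) (N : submod M) :=
  GRing.isZmodMorphism.Build _ _ (@quo_pi R M N) (@quo_pi_is_additive R M N).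

Definition quo_scale (R : pzRingType) (M : lmodType R) (N : submod M) (a : R)
  (u : quo_module N) : quo_module N :=
  quo_pi N (a *: repr (u : Quotient.quot (submod_pred N))).

Lemma quo_scaleE (R : pzRingType) (M : lmodType R) (N : submod M) (a : R)
  (x : M) : quo_scale a (quo_pi N x) = quo_pi N (a *: x).
Proof.
apply/quo_pi_eq; rewrite -scalerBr; apply: rpredZ; apply/quo_pi_eq.
exact: (@reprK _ (Quotient.quot (submod_pred N))).
Qed.

Lemma quo_scaleA (R : pzRingType) (M : lmodType R) (N : submod M) (a b : R)
  (u : quo_module N) : quo_scale a (quo_scale b u) = quo_scale (a * b) u.
Proof. by have [x ->] := quo_pi_surj u; rewrite !quo_scaleE scalerA. Qed.
Lemma quo_scale1 (R : pzRingType) (M : lmodType R) (N : submod M) :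
  left_id 1 (@quo_scale R M N).
Proof.
by move=> u; have [x ->] := quo_pi_surj u; rewrite quo_scaleE scale1r.
Qed.
Lemma quo_scaleDr (R : pzRingType) (M : lmodType R) (N : submod M) :
  right_distributive (@quo_scale R M N) +%R.
Proof.
move=> a u v; have [x ->] := quo_pi_surj u; have [y ->] := quo_pi_surj v.
by rewrite -raddfD !quo_scaleE scalerDr raddfD.
Qed.
Lemma quo_scaleDl (R : pzRingType) (M : lmodType R) (N : submod M)
  (u : quo_module N) : {morph (@quo_scale R M N)^~ u : a b / a + b}.
Proof.
move=> a b; have [x ->] := quo_pi_surj u.
by rewrite !quo_scaleE scalerDl raddfD.
Qed.
HB.instance Definition _ (R : pzRingType) (M : lmodType R) (N : submod M) :=
  GRing.Zmodule_isLmodule.Build R (quo_module N) (@quo_scaleA R M N)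
    (@quo_scale1 R M N) (@quo_scaleDr R M N) (@quo_scaleDl R M N).

Lemma quo_pi_linear (R : pzRingType) (M : lmodType R) (N : submod M) :
  linear (@quo_pi R M N).
Proof.
move=> a x y; rewrite raddfD; congr (_ + _).
by rewrite -[RHS]/(quo_scale _ _) quo_scaleE.
Qed.
HB.instance Definition _ (R : pzRingType) (M : lmodType R) (N : submod M) :=
  GRing.isLinear.Build R M (quo_module N) *:%R (@quo_pi R M N)
    (@quo_pi_linear R M N).

Definition lin_quo (R : pzRingType) (M : lmodType R) (N : submod M) :
  {linear M -> quo_module N} := @quo_pi R M N.
Definition lin_sub (R : pzRingType) (M : lmodType R) (N : submod M) :
  {linear sub_module N -> M} := @sub_inj R M N.

Definition mk_linear (R : pzRingType) (U V : lmodType R) (f : U -> V)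
    (lf : linear f) : {linear U -> V} :=
  HB.pack f (GRing.isLinear.Build R U V *:%R f lf).

Lemma linE (R : pzRingType) (M N : rmod R) (f g : @mor (Mod R) M N) (x : M) :
  f = g -> (f : {linear M -> N}) x = (g : {linear M -> N}) x.
Proof. by move=> ->. Qed.

Lemma mk_iso (R : pzRingType) (M N : rmod R) (f : {linear M -> N}) :
  injective f -> (forall y, exists x, f x = y) -> @is_iso (Mod R) M N f.
Proof.
move=> fI fS; pose g y := sval (cid (fS y)).
have gK : cancel g f by move=> y; apply: (svalP (cid (fS y))).
have fK : cancel f g by move=> x; apply: fI; rewrite gK.
have gl : linear g by move=> a x y; apply: fI; rewrite gK linearP !gK.
by exists (mk_linear gl); split; apply: linear_ext => x /=; rewrite ?fK ?gK.
Qed.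

Lemma Mod_zero_object (R : pzRingType) (M : rmod R) :
  @is_zero_object (Mod R) M <-> (forall x : M, x = 0).
Proof.
split=> [/zero_objectP z x|z]; last first.
  by apply/zero_objectP; apply: linear_ext => x; apply: z.
exact: linE x z.
Qed.

Lemma elt_hom_linear (R : pzRingType) (M : rmod R) (x : M) :
  linear (fun r : regular_rmod R => ract x r).
Proof. by move=> a r s; rewrite /ract scalerDl scalerA. Qed.

(** The regular module is free on [1], so these maps translate between elements of [M] and morphisms
    of [Mod R]. *)
Definition elt_hom (R : pzRingType) (M : rmod R) (x : M) :
  {linear regular_rmod R -> M} := mk_linear (elt_hom_linear x).

Lemma Mod_mono_inj (R : pzRingType) (M N : rmod R) (f : {linear M -> N}) :
  @mono (Mod R) M N f -> injective f.
Proof.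
move=> mf x y fxy; have : elt_hom x = elt_hom y.
  apply: (mf (regular_rmod R) (elt_hom x) (elt_hom y)); apply: linear_ext => r.
  rewrite -[LHS]/(f (ract x r)) -[RHS]/(f (ract y r)) /ract !linearZ.
  by rewrite /= fxy.
move=> e; have := @linE _ _ _ (elt_hom x) (elt_hom y) 1 e.
by rewrite -[X in X = _ -> _]/(ract x 1) -[X in _ = X -> _]/(ract y 1)
  /ract !scale1r.
Qed.

Lemma ker_submodule (R : pzRingType) (M N : lmodType R) (f : {linear M -> N}) :
  submodule (fun x => f x = 0).
Proof.
split=> [|x y fx fy|a x fx]; first by rewrite raddf0.
  by rewrite raddfD /= fx fy addr0.
by rewrite linearZ /= fx scaler0.
Qed.

Lemma img_submodule (R : pzRingType) (M N : lmodType R) (f : {linear M -> N}) :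
  submodule (fun y => exists x, f x = y).
Proof.
split=> [|_ _ [x <-] [y <-]|a _ [x <-]]; first by exists 0; rewrite raddf0.
  by exists (x + y); rewrite raddfD.
by exists (a *: x); rewrite linearZ.
Qed.

Lemma sub_kernel (R : pzRingType) (L M N : rmod R) (k : {linear L -> M})
    (f : {linear M -> N}) :
  injective k -> (forall x, f x = 0 <-> exists y, k y = x) ->
  @is_kernel (Mod R) L M N k f.
Proof.
move=> kI fk; split; first by apply: linear_ext => x; apply/fk; exists x.
move=> W g fg; have gP w : exists y, k y = (g : {linear _ -> _}) w.
  by apply/fk; apply: linE w fg.
pose u w := sval (cid (gP w)).
have uP w : k (u w) = (g : {linear _ -> _}) w by apply: (svalP (cid (gP w))).
have ul : linear u by move=> a x y; apply: kI; rewrite linearP !uP linearP.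
exists (mk_linear ul); split; first by apply: linear_ext => w; apply: uP.
move=> v kv; apply: linear_ext => w; apply: kI; rewrite uP.
exact: linE w (esym kv).
Qed.

Lemma quo_cokernel (R : pzRingType) (M N Q : rmod R) (q : {linear N -> Q})
    (f : {linear M -> N}) :
  (forall y, exists x, q x = y) -> (forall x, q x = 0 <-> exists y, f y = x) ->
  @is_cokernel (Mod R) M N Q q f.
Proof.
move=> qS qf; split; first by apply: linear_ext => x; apply/qf; exists x.
move=> Z g gf; have gK x y : q x = q y ->
    (g : {linear _ -> _}) x = (g : {linear _ -> _}) y.
  move=> qxy; apply/eqP; rewrite -subr_eq0 -raddfB; apply/eqP.
  have [|z <-] := (qf (x - y)).1; first by rewrite raddfB /= qxy subrr.
  exact: linE z gf.
pose s y := sval (cid (qS y)); have sK y : q (s y) = y.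
  exact: (svalP (cid (qS y))).
pose u y := (g : {linear _ -> _}) (s y).
have ul : linear u.
  by move=> a x y; rewrite /u -linearP; apply: gK; rewrite linearP !sK.
exists (mk_linear ul); split.
  by apply: linear_ext => x; apply: gK; rewrite sK.
move=> v vq; apply: linear_ext => y; rewrite -[in RHS](sK y).
exact: linE (s y) (esym vq).
Qed.

Lemma Mod_kernel (R : pzRingType) (M N : rmod R) (f : {linear M -> N}) :
  @is_kernel (Mod R) _ M N (lin_sub (to_submod (ker_submodule f))) f.
Proof.
apply: sub_kernel => [|x]; first exact: val_inj.
split=> [fx|[y <-]]; last exact/asboolP/(subP y).
have xP : x \in submod_pred (to_submod (ker_submodule f)) by apply/asboolP.
by exists (SubElt xP).
Qed.

Lemma lin_quo0 (R : pzRingType) (M : lmodType R) (N : submod M) x :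
  lin_quo N x = 0 <-> x \in submod_pred N.
Proof.
have /= := quo_pi_eq N x 0; rewrite subr0 => <-.
by rewrite (raddf0 (@quo_pi R M N)).
Qed.

Lemma Mod_cokernel (R : pzRingType) (M N : rmod R) (f : {linear M -> N}) :
  @is_cokernel (Mod R) M N _ (lin_quo (to_submod (img_submodule f))) f.
Proof.
apply: quo_cokernel => [y|x].
  by have [x ->] := quo_pi_surj y; exists x.
by rewrite lin_quo0; split=> [/asboolP //|?]; apply/asboolP.
Qed.

(** The projection onto the quotient by the image of [f] is zero after [f], hence zero when [f] is
    epi, so every element lies in the image. *)
Lemma Mod_epi_surj (R : pzRingType) (M N : rmod R) (f : {linear M -> N}) :
  @epi (Mod R) M N f -> forall y, exists x, f x = y.
Proof.
move=> ef y; apply/asboolP.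
apply: (lin_quo0 (to_submod (img_submodule f)) y).1.
have : lin_quo (to_submod (img_submodule f)) = 0.
  by apply: (ef _); rewrite (Mod_cokernel f).1 comp0l.
move=> e; exact: linE y e.
Qed.

Lemma Mod_biproduct (R : pzRingType) (M N : rmod R) :
  @is_biproduct (Mod R) M N (M * N)%type.
Proof.
have i1l : linear (fun x : M => (x, 0) : M * N).
  by move=> a x y; congr (_, _); rewrite /= scaler0 addr0.
have i2l : linear (fun x : N => (0, x) : M * N).
  by move=> a x y; congr (_, _); rewrite /= scaler0 addr0.
have p1l : linear (fun x : (M * N)%type => x.1) by [].
have p2l : linear (fun x : (M * N)%type => x.2) by [].
exists (mk_linear i1l), (mk_linear i2l), (mk_linear p1l), (mk_linear p2l).
split; apply: linear_ext => // -[x y] /=.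
by congr (_, _); rewrite /= ?addr0 ?add0r.
Qed.

Lemma Mod_abelian (R : pzRingType) : is_abelian (Mod R).
Proof.
split.
(* The zero module is realised as the kernel of an identity map. *)
- exists (sub_module (to_submod (ker_submodule (lin_id (regular_rmod R))))
      : rmod R).
  by apply/Mod_zero_object => x; apply: val_inj; apply/asboolP/(subP x).
- by move=> M N; exists ((M * N)%type : rmod R); apply: Mod_biproduct.
- by move=> M N f; eexists _, _; apply: Mod_kernel.
- by move=> M N f; eexists _, _; apply: Mod_cokernel.
- move=> M N f mf; exists (quo_module (to_submod (img_submodule f)) : rmod R),
    (lin_quo (to_submod (img_submodule f))).
  apply: sub_kernel (Mod_mono_inj mf) _ => x.
  by rewrite lin_quo0; split=> [/asboolP //|?]; apply/asboolP.
- move=> M N f ef; exists (sub_module (to_submod (ker_submodule f)) : rmod R),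
    (lin_sub (to_submod (ker_submodule f))).
  apply: quo_cokernel (Mod_epi_surj ef) _ => x.
  split=> [fx|[y <-]]; last exact/asboolP/(subP y).
  have xP : x \in submod_pred (to_submod (ker_submodule f)) by apply/asboolP.
  by exists (SubElt xP).
Qed.

(** * The tensor-hom adjunction *)

Record balanced (S T : pzRingType) (P : bimodule S T) (X : rmod S)
    (Z : zmodType) (b : X -> P -> Z) : Prop := Balanced {
  balDl : forall x y p, b (x + y) p = b x p + b y p;
  balDr : forall x p q, b x (p + q) = b x p + b x q;
  bal_mid : forall x s p, b (ract x s) p = b x (lact P s p)
}.

(** [fglift] expects values in a module over the coefficients, so the group [Z] is viewed as a
    module over [int] through [zmodule]. *)
Definition freeg_ext (K : choiceType) (Z : zmodType) (b : K -> Z)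
  (u : {freeg K / int}) : Z := fglift (b : K -> zmodule Z) u.

Lemma freeg_extB (K : choiceType) (Z : zmodType) (b : K -> Z) :
  zmod_morphism (freeg_ext b).
Proof. exact: (@lift_is_additive int K (zmodule Z : lmodType int) b). Qed.

HB.instance Definition _ (K : choiceType) (Z : zmodType) (b : K -> Z) :=
  GRing.isZmodMorphism.Build _ _ (freeg_ext b) (freeg_extB b).

Lemma freeg_extU (K : choiceType) (Z : zmodType) (b : K -> Z) k :
  freeg_ext b << k >> = b k.
Proof.
rewrite /freeg_ext (@liftU int (zmodule Z : lmodType int)).
exact: mulr1z.
Qed.

Definition tens_lift (S T : pzRingType) (P : bimodule S T) (X : rmod S)
  (Z : zmodType) (b : X -> P -> Z) (u : Tens P X) : Z :=
  freeg_ext (fun k => b k.1 k.2)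
    (repr (u : Quotient.quot (@tens_pred S T P X))).

(** The extension of a balanced map to the free group vanishes on all relators, so the
    representative picked by [repr] does not matter. *)
Lemma tens_lift_pi (S T : pzRingType) (P : bimodule S T) (X : rmod S)
    (Z : zmodType) (b : X -> P -> Z) u :
  balanced b -> tens_lift b (tens_pi u) = freeg_ext (fun k => b k.1 k.2) u.
Proof.
move=> [bDl bDr bM]; apply/eqP; rewrite -subr_eq0 -raddfB; apply/eqP.
have : tens_rel (repr (tens_pi u : (Quotient.quot (@tens_pred S T P X))) - u).
  apply/tens_pi_eq; exact: (@reprK _ (Quotient.quot (@tens_pred S T P X))).
elim=> [|v w _ IHv _ IHw|x y p|x p q|x s p];
  rewrite ?raddf0 ?raddfB /= ?freeg_extU ?raddfB /= ?freeg_extU /=.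
- by [].
- by rewrite IHv IHw subr0.
- by rewrite bDl [_ + b y p]addrC addrK subrr.
- by rewrite bDr [_ + b x q]addrC addrK subrr.
- by rewrite bM subrr.
Qed.

Lemma tens_liftE (S T : pzRingType) (P : bimodule S T) (X : rmod S)
    (Z : zmodType) (b : X -> P -> Z) x p :
  balanced b -> tens_lift b (tens x p) = b x p.
Proof. by move=> bb; rewrite tens_lift_pi // freeg_extU. Qed.

Lemma tens_liftB (S T : pzRingType) (P : bimodule S T) (X : rmod S)
    (Z : zmodType) (b : X -> P -> Z) :
  balanced b -> zmod_morphism (tens_lift b).
Proof.
move=> bb u v; rewrite -[u](@reprK _ (Quotient.quot (@tens_pred S T P X))).
rewrite -[v](@reprK _ (Quotient.quot (@tens_pred S T P X))).
rewrite -/(tens_pi (repr u)) -/(tens_pi (repr v)) -raddfB.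
by rewrite !tens_lift_pi // raddfB.
Qed.

Lemma tens_additive_ext (S T : pzRingType) (P : bimodule S T) (X : rmod S)
    (Z : zmodType) (f g : Tens P X -> Z) :
  zmod_morphism f -> zmod_morphism g ->
  (forall x p, f (tens x p) = g (tens x p)) -> f =1 g.
Proof.
move=> fB gB fg; elim/tens_ind => [|u v fgu fgv|x p //].
  by rewrite -[0 in LHS](subrr 0) -[0 in RHS](subrr 0) fB gB !subrr.
by rewrite fB gB fgu fgv.
Qed.

Lemma tens_lift_linear (S T : pzRingType) (P : bimodule S T) (X : rmod S)
    (M : rmod T) (b : X -> P -> M) :
  balanced b -> (forall x p (t : T^c), b x (t *: p) = t *: b x p) ->
  linear (tens_lift b).
Proof.
move=> bb bZ; have bB := tens_liftB bb.
have b0 : tens_lift b 0 = 0 by rewrite -[0 in LHS](subrr 0) bB subrr.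
have bD u v : tens_lift b (u + v) = tens_lift b u + tens_lift b v.
  by rewrite -[in LHS](opprK v) bB -[- v]sub0r bB b0 sub0r opprK.
move=> a u v; rewrite bD; congr (_ + _); move: u; apply: tens_additive_ext.
- by move=> u w; rewrite scalerBr bB.
- by move=> u w; rewrite bB scalerBr.
move=> x p; rewrite -[_ *: tens x p]/(tens_scale _ _) tens_scaleE.
by rewrite !tens_liftE.
Qed.

Lemma tens_lin_ext (S T : pzRingType) (P : bimodule S T) (X : rmod S)
    (M : rmod T) (f g : {linear Tens P X -> M}) :
  (forall x p, f (tens x p) = g (tens x p)) -> f = g.
Proof.
move=> fg; apply: linear_ext; apply: tens_additive_ext fg => u v;
by rewrite raddfB.
Qed.

Lemma tensZr (S T : pzRingType) (P : bimodule S T) (X : rmod S) (x : X) (p : P)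
  (t : T^c) : t *: tens x p = tens x (t *: p).
Proof. by rewrite -[LHS]/(tens_scale _ _) tens_scaleE. Qed.

Lemma tens_unit_linear (S T : pzRingType) (P : bimodule S T) (X : rmod S)
  (x : X) : linear (tens x : bimod_car P -> Tens P X).
Proof. by move=> a p q; rewrite tensDr tensZr. Qed.

Lemma tens_unit_linear2 (S T : pzRingType) (P : bimodule S T) (X : rmod S) :
  linear (fun x : X =>
    mk_linear (U := bimod_car P) (tens_unit_linear x) : Hom P (Tens P X)).
Proof.
move=> a x y; apply: linear_ext => p.
by rewrite /= tensDl -tens_mid.
Qed.

Definition tens_unit (S T : pzRingType) (P : bimodule S T) (X : rmod S) :
  {linear X -> Hom P (Tens P X)} := mk_linear (@tens_unit_linear2 S T P X).

Lemma tens_counit_balanced (S T : pzRingType) (P : bimodule S T) (M : rmod T) :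
  balanced (fun (h : Hom P M) p => (h : {linear P -> M}) p).
Proof. by split=> // h p q; rewrite raddfD. Qed.

Lemma tens_counit_linear (S T : pzRingType) (P : bimodule S T) (M : rmod T) :
  linear (tens_lift (fun (h : Hom P M) p => (h : {linear P -> M}) p)).
Proof.
apply: tens_lift_linear => [|x p t]; first exact: tens_counit_balanced.
exact: linearZ.
Qed.

Definition tens_counit (S T : pzRingType) (P : bimodule S T) (M : rmod T) :
  {linear Tens P (Hom P M : rmod S) -> M} :=
  mk_linear (@tens_counit_linear S T P M).

Lemma tens_counitE (S T : pzRingType) (P : bimodule S T) (M : rmod T)
  (h : {linear P -> M}) p :
  tens_counit P M (tens (h : Hom P M) p) = h p.
Proof. by rewrite /= tens_liftE //; apply: tens_counit_balanced. Qed.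

Lemma Tens_Hom_unit_counit (S T : pzRingType) (P : bimodule S T) :
  @unit_counit (Mod S) (Mod T) (Tens_functor P) (Hom_functor P)
    (@tens_unit S T P) (@tens_counit S T P).
Proof.
split.
- move=> X Y f; apply: linear_ext => x; apply: linear_ext => p.
  exact: Tens_funE.
- move=> M N f; apply: tens_lin_ext => h p.
  rewrite -[LHS]/(tens_counit P N (Tens_fun _ (tens h p))) Tens_funE.
  by rewrite -[RHS]/(_ (tens_counit P M (tens h p))) !tens_counitE.
- move=> X; apply: tens_lin_ext => x p.
  rewrite -[LHS]/(tens_counit P _ (Tens_fun _ (tens x p))) Tens_funE.
  by rewrite tens_counitE.
- move=> M; apply: linear_ext => h; apply: linear_ext => p.
  exact: tens_counitE.
Qed.

Lemma Tens_Hom_adjoint (S T : pzRingType) (P : bimodule S T) :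
  @adjoint (Mod S) (Mod T) (Tens_functor P) (Hom_functor P).
Proof. exact: unit_counit_adjoint (@Tens_Hom_unit_counit S T P). Qed.

Lemma Hom_functor_additive (S T : pzRingType) (P : bimodule S T) :
  additive_functor (Hom_functor P).
Proof. by move=> X Y f g; apply: linear_ext => h; apply: linear_ext. Qed.

Lemma Tens_functor_additive (S T : pzRingType) (P : bimodule S T) :
  additive_functor (Tens_functor P).
Proof.
move=> X Y f g; apply: tens_lin_ext => x p.
rewrite -[RHS]/(Tens_fun f (tens x p) + Tens_fun g (tens x p)).
by rewrite -[LHS]/(Tens_fun _ (tens x p)) !Tens_funE -tensDl.
Qed.

Lemma restr_functor_additive (R Q : pzRingType) (h : {rmorphism R -> Q}) :
  additive_functor (restr_functor h).
Proof. by move=> X Y f g; apply: linear_ext. Qed.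

(** * The recollement induced by an idempotent *)

Lemma ractA (R : pzRingType) (M : rmod R) (x : M) (r s : R) :
  ract (ract x r) s = ract x (r * s).
Proof. exact: scalerA. Qed.
Lemma ract1 (R : pzRingType) (M : rmod R) (x : M) : ract x 1 = x.
Proof. exact: scale1r. Qed.
Lemma ract0r (R : pzRingType) (M : rmod R) (x : M) : ract x 0 = 0.
Proof. exact: scale0r. Qed.
Lemma ract0l (R : pzRingType) (M : rmod R) (r : R) : ract (0 : M) r = 0.
Proof. exact: scaler0. Qed.
Lemma ractDr (R : pzRingType) (M : rmod R) (x : M) (r s : R) :
  ract x (r + s) = ract x r + ract x s.
Proof. exact: scalerDl. Qed.
Lemma ractBr (R : pzRingType) (M : rmod R) (x : M) (r s : R) :
  ract x (r - s) = ract x r - ract x s.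
Proof. exact: scalerBl. Qed.
Lemma ractDl (R : pzRingType) (M : rmod R) (x y : M) (r : R) :
  ract (x + y) r = ract x r + ract y r.
Proof. exact: scalerDr. Qed.
Lemma ractZ (R : pzRingType) (M N : rmod R) (f : {linear M -> N}) (x : M) r :
  f (ract x r) = ract (f x) r.
Proof. exact: linearZ. Qed.

Lemma eS_one_subproof (S : pzRingType) (e : idempotent_elt S) :
  (e : S) \in eS_pred e.
Proof. by rewrite unfold_in idemE. Qed.
Definition eS_one (S : pzRingType) (e : idempotent_elt S) : eS e :=
  ESElt (eS_one_subproof e).

Lemma Se_one_subproof (S : pzRingType) (e : idempotent_elt S) :
  (e : S) \in Se_pred e.
Proof. by rewrite unfold_in idemE. Qed.
Definition Se_one (S : pzRingType) (e : idempotent_elt S) : Se e :=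
  SeElt (Se_one_subproof e).

Lemma eS_gen (S : pzRingType) (e : idempotent_elt S) (p : eS e) :
  p = ract (eS_one e) (p : S).
Proof. by apply: val_inj; apply: (esym (eSl p)). Qed.

Lemma eS_hom_linear (S : pzRingType) (e : idempotent_elt S) (Y : rmod S)
  (y : Y) : linear (fun p : eS e => ract y (p : S)).
Proof. by move=> a p q; rewrite ractDr -ractA. Qed.
Definition eS_hom (S : pzRingType) (e : idempotent_elt S) (Y : rmod S)
  (y : Y) : {linear eS e -> Y} := mk_linear (eS_hom_linear (e := e) y).

(** Evaluation at [e] identifies [Hom(eS, Y)] with [Y e]: a map [h] is determined by
    [h e = (h e) e], and [y e] is the value at [e] of the map [eS_hom e y]. *)
Lemma in_ker_Hom_eS (S : pzRingType) (e : idempotent_elt S) (Y : rmod S) :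
  in_ker (Hom_functor (eS_bimod e)) Y <-> forall y : Y, ract y (e : S) = 0.
Proof.
split=> [/Mod_zero_object kY y|kY].
  exact: (linE (M := eS e) (eS_one e) (kY (eS_hom e y))).
apply/Mod_zero_object => h; apply: linear_ext => p.
have -> : (h : {linear eS e -> Y}) p =
    ract ((h : {linear eS e -> Y}) (eS_one e)) (p : S).
  by rewrite [in LHS](eS_gen p) ractZ.
have -> : eS_one e = ract (eS_one e) (e : S) by apply: eS_gen.
by rewrite ractZ kY ract0l.
Qed.

Lemma eS_Se_subproof (S : pzRingType) (e : idempotent_elt S) (p : eS e)
  (q : Se e) : (p : S) * (q : S) \in corner_pred e.
Proof. by rewrite unfold_in mulrA eSl -mulrA Ser. Qed.
Definition eS_Se (S : pzRingType) (e : idempotent_elt S) (p : eS e)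
  (q : Se e) : corner e := Corner (eS_Se_subproof p q).

Lemma Se_gen (S : pzRingType) (e : idempotent_elt S) (q : Se e) :
  Se_lact (q : S) (Se_one e) = q.
Proof. by apply: val_inj; apply: Ser. Qed.

(** This lemma and the next two give linearity in [p], [q] and [x] of the formula [x (q p)], which
    is the unit of the adjunction between [Hom(eS, -)] and [Hom(Se, -)]. *)
Lemma corner_unit_in_linear (S : pzRingType) (e : idempotent_elt S)
  (X : rmod S) (x : X) (q : Se e) :
  linear (fun p : eS e => ract x ((q : S) * (p : S))).
Proof.
move=> a p p'; rewrite mulrDr ractDr; congr (_ + _).
by rewrite -[RHS]/(ract (ract x _) a) ractA -mulrA.
Qed.

Lemma corner_unit_linear1 (S : pzRingType) (e : idempotent_elt S)
  (X : rmod S) (x : X) :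
  linear (fun q : Se e =>
    mk_linear (corner_unit_in_linear x q) : Hom (eS_bimod e) X).
Proof.
move=> a q q'; apply: linear_ext => p /=.
rewrite mulrDl ractDr; congr (ract x _ + _).
exact: (esym (mulrA (q : S) (corner_val a) (p : S))).
Qed.

Lemma corner_unit_linear2 (S : pzRingType) (e : idempotent_elt S)
  (X : rmod S) :
  linear (fun x : X => mk_linear (corner_unit_linear1 (e := e) x)
    : Hom (Se_bimod e) (Hom (eS_bimod e) X)).
Proof.
move=> a x y; apply: linear_ext => q; apply: linear_ext => p /=.
rewrite ractDl; congr (_ + _).
by rewrite -[a *: x]/(ract x (a : S)) ractA mulrA.
Qed.

Definition corner_unit (S : pzRingType) (e : idempotent_elt S) (X : rmod S) :
    {linear X -> Hom (Se_bimod e) (Hom (eS_bimod e) X)} :=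
  mk_linear (@corner_unit_linear2 S e X).

Definition corner_eval (S : pzRingType) (e : idempotent_elt S)
  (M : rmod (corner e)) (h : Hom (eS_bimod e) (Hom (Se_bimod e) M)) (p : eS e)
  (q : Se e) : M :=
  ((h : {linear eS e -> _}) p : {linear Se e -> M}) q.

(** Writing [p = e p], linearity in the first slot moves [p] onto [q]; the product [p q] lies in the
    corner, so it leaves the second slot as a scalar. Thus [h] is determined by its value at [e],
    [e]. *)
Lemma corner_evalE (S : pzRingType) (e : idempotent_elt S)
  (M : rmod (corner e)) (h : Hom (eS_bimod e) (Hom (Se_bimod e) M)) (p : eS e)
  (q : Se e) :
  corner_eval h p q = ract (corner_eval h (eS_one e) (Se_one e)) (eS_Se p q).
Proof.
rewrite /corner_eval [in LHS](eS_gen p) ractZ.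
rewrite -[LHS]/(corner_eval h (eS_one e) (Se_lact (p : S) q)) /corner_eval.
rewrite -[RHS]ractZ; congr (GRing.Linear.sort _ _).
by apply: val_inj; rewrite /= mulrA eSl.
Qed.

Lemma corner_counit_linear (S : pzRingType) (e : idempotent_elt S)
  (M : rmod (corner e)) :
  linear (fun h : Hom (eS_bimod e) (Hom (Se_bimod e) M) =>
    corner_eval h (eS_one e) (Se_one e)).
Proof.
move=> a h h'; rewrite -[LHS]/(corner_eval (a *: h) _ _ + corner_eval h' _ _).
congr (_ + _); rewrite -[LHS]/(corner_eval h (eS_lact a (eS_one e)) _).
rewrite corner_evalE; congr (ract _ _); apply: val_inj => /=.
by rewrite !corner_r.
Qed.

Definition corner_counit (S : pzRingType) (e : idempotent_elt S)
    (M : rmod (corner e)) :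
    {linear Hom (eS_bimod e) (Hom (Se_bimod e) M) -> M} :=
  mk_linear (@corner_counit_linear S e M).

Lemma corner_unit_counit (S : pzRingType) (e : idempotent_elt S) :
  @unit_counit (Mod S) (Mod (corner e)) (Hom_functor (eS_bimod e))
    (Hom_functor (Se_bimod e)) (@corner_unit S e) (@corner_counit S e).
Proof.
split.
- move=> X Y f; apply: linear_ext => x; apply: linear_ext => q.
  by apply: linear_ext => p; apply: ractZ.
- by move=> X Y f; apply: linear_ext => h.
- move=> X; apply: linear_ext => h; apply: linear_ext => p.
  rewrite -[LHS]/(ract ((h : {linear eS e -> X}) (eS_one e))
    ((e : S) * (p : S))).
  by rewrite eSl -ractZ -eS_gen.
- move=> M; apply: linear_ext => g; apply: linear_ext => q.
  rewrite -[LHS]/((g : {linear Se e -> M})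
    (Se_lact ((q : S) * (e : S)) (Se_one e))).
  by rewrite Ser Se_gen.
Qed.

Lemma corner_adjoint (S : pzRingType) (e : idempotent_elt S) :
  @adjoint (Mod S) (Mod (corner e)) (Hom_functor (eS_bimod e))
    (Hom_functor (Se_bimod e)).
Proof. exact: unit_counit_adjoint (@corner_unit_counit S e). Qed.

Lemma corner_section_in_linear (S : pzRingType) (e : idempotent_elt S)
  (M : rmod (corner e)) (m : M) (p : eS e) :
  linear (fun q : Se e => ract m (eS_Se p q)).
Proof.
move=> a q q'; rewrite -[a *: ract _ _]/(ract (ract _ _) (a : corner e)) ractA.
rewrite -ractDr; congr (ract _ _); apply: val_inj => /=.
by rewrite mulrDr; congr (_ + _); apply: mulrA.
Qed.

Lemma corner_section_linear (S : pzRingType) (e : idempotent_elt S)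
  (M : rmod (corner e)) (m : M) :
  linear (fun p : eS e =>
    mk_linear (corner_section_in_linear m p) : Hom (Se_bimod e) M).
Proof.
move=> a p p'; apply: linear_ext => q /=; rewrite -ractDr.
congr (ract _ _); apply: val_inj => /=.
by rewrite mulrDl; congr (_ + _); apply: (esym (mulrA _ _ _)).
Qed.

Lemma corner_counit_iso (S : pzRingType) (e : idempotent_elt S)
    (M : rmod (corner e)) :
  @is_iso (Mod (corner e)) _ M (corner_counit M).
Proof.
apply: mk_iso => [h h' hh'|m].
  apply: linear_ext => p; apply: linear_ext => q.
  rewrite -[LHS]/(corner_eval h p q) -[RHS]/(corner_eval h' p q).
  by rewrite corner_evalE [RHS]corner_evalE; congr (ract _ _); apply: hh'.
(* The preimage of [m] is the map sending [p], [q] to [m (p q)]; at [e], [e] the scalar is the unit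
   of the corner ring. *)
exists (mk_linear (corner_section_linear m)).
rewrite -[LHS]/(ract m (eS_Se (eS_one e) (Se_one e))) -[RHS]ract1.
by congr (ract _ _); apply: val_inj; apply: idemE.
Qed.

Lemma corner_ff (S : pzRingType) (e : idempotent_elt S) :
  @fully_faithful (Mod (corner e)) (Mod S) (Hom_functor (Se_bimod e)).
Proof.
exact: counit_iso_right_adjoint_ff (@corner_unit_counit S e)
  (@corner_counit_iso S e).
Qed.

(** * Modules over a quotient ring *)

Lemma regular_gen (R : pzRingType) (r : regular_rmod R) :
  r = ract (1 : regular_rmod R) r.
Proof. exact: (esym (mul1r (r : R))). Qed.

Lemma quot_eval_linear (R : pzRingType) (I : ideal R)
  (Y : rmod (quotient_ring I)) :
  linear (fun f : Hom (quot_bimod_left I) Y =>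
    (f : {linear regular_rmod (quotient_ring I) -> Y}) 1 : restr (@qpi R I) Y).
Proof.
move=> a f g; congr (_ + _).
rewrite -[LHS]/((f : {linear regular_rmod (quotient_ring I) -> Y})
  (lmul (qpi I a) (1 : quotient_ring I))) -[RHS]/(ract _ (qpi I a)) -ractZ.
congr (GRing.Linear.sort _ _).
by rewrite -[LHS]/(qpi I a * 1) -[RHS]/(1 * qpi I a) mul1r mulr1.
Qed.

(** Evaluation at [1] is the isomorphism. It hands the left adjoint of the Hom functor, given by the
    tensor product, over to restriction of scalars. *)
Lemma quot_Hom_restr (R : pzRingType) (I : ideal R) :
  @nat_iso (Mod (quotient_ring I)) (Mod R) (Hom_functor (quot_bimod_left I))
    (restr_functor (@qpi R I)).
Proof.
exists (fun Y => mk_linear (@quot_eval_linear R I Y)); split=> [X Y f|Y].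
  exact: linear_ext.
apply: mk_iso => [f g fg|y].
  apply: linear_ext => r; rewrite [r]regular_gen !ractZ.
  by congr (ract _ _); apply: fg.
by exists (elt_hom (y : Y)); apply: ract1.
Qed.

Lemma quot_left_adjoint (R : pzRingType) (I : ideal R) :
  @adjoint (Mod R) (Mod (quotient_ring I)) (Tens_functor (quot_bimod_left I))
    (restr_functor (@qpi R I)).
Proof.
exact: adjoint_nat_iso_r (@quot_Hom_restr R I)
  (@Tens_Hom_adjoint _ _ (quot_bimod_left I)).
Qed.

Lemma quot_unit_in_linear (R : pzRingType) (I : ideal R)
  (Y : rmod (quotient_ring I)) (y : Y) :
  linear (fun u : restr (@qpi R I) (regular_rmod (quotient_ring I)) =>
    ract y u : restr (@qpi R I) Y).
Proof.
move=> a u v; rewrite -[RHS]/(ract (ract y u) (qpi I a) + ract y v).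
by rewrite ractA -ractDr.
Qed.

Lemma quot_unit_linear (R : pzRingType) (I : ideal R)
  (Y : rmod (quotient_ring I)) :
  linear (fun y : Y => mk_linear (quot_unit_in_linear y) :
    Hom (quot_bimod_right I) (restr (@qpi R I) Y)).
Proof.
move=> a x y; apply: linear_ext => u.
rewrite -[LHS]/(ract (ract x (a : quotient_ring I) + y) u).
by rewrite ractDl ractA.
Qed.

Lemma quot_counit_linear (R : pzRingType) (I : ideal R) (X : rmod R) :
  linear (fun f : restr (@qpi R I) (Hom (quot_bimod_right I) X) =>
    (f : {linear restr (@qpi R I) (regular_rmod (quotient_ring I)) -> X})
      (1 : quotient_ring I)).
Proof.
move=> a f g; congr (_ + _).
pose f' : {linear restr (@qpi R I) (regular_rmod (quotient_ring I)) -> X} := f.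
change (f' (lmul (qpi I a) (1 : quotient_ring I)) =
  ract (f' (1 : quotient_ring I)) a).
rewrite -ractZ; congr (f' _).
change (qpi I a * 1 = 1 * qpi I a).
by rewrite mulr1 mul1r.
Qed.

Lemma quot_right_adjoint (R : pzRingType) (I : ideal R) :
  @adjoint (Mod (quotient_ring I)) (Mod R) (restr_functor (@qpi R I))
    (Hom_functor (quot_bimod_right I)).
Proof.
apply: (@unit_counit_adjoint (Mod (quotient_ring I)) (Mod R)
  (restr_functor (@qpi R I)) (Hom_functor (quot_bimod_right I))
  (fun Y => mk_linear (@quot_unit_linear R I Y))
  (fun X => mk_linear (@quot_counit_linear R I X))).
split.
- move=> X Y f; apply: linear_ext => x; apply: linear_ext => u.
  exact: (ractZ (f : {linear X -> Y})).
- by move=> X Y f; apply: linear_ext.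
- by move=> X; apply: linear_ext => x; apply: ract1.
- move=> X; apply: linear_ext => f; apply: linear_ext => u.
  pose f' : {linear restr (@qpi R I) (regular_rmod (quotient_ring I)) -> X} := f.
  change (f' ((u : quotient_ring I) * 1) = f' u).
  by rewrite mulr1.
Qed.

(** Every scalar of the quotient ring is the class of an element of [R], so linearity over [R] is
    already linearity over the quotient. *)
Lemma quot_restr_ff (R : pzRingType) (I : ideal R) :
  @fully_faithful (Mod (quotient_ring I)) (Mod R) (restr_functor (@qpi R I)).
Proof.
move=> M N; have gl (g : {linear restr (@qpi R I) M -> restr (@qpi R I) N}) :
    linear (g : M -> N).
  move=> a x y; rewrite -[a](qreprK (a : quotient_ring I)).
  exact: (linearP g).
exists (fun g => mk_linear (gl g)) => f; exact: linear_ext.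
Qed.


Definition annihilated (R : pzRingType) (I : ideal R) (X : rmod R) : Prop :=
  forall (x : X) a, a \in ideal_pred I -> ract x a = 0.

(** An alias of [X] that carries the action of the quotient ring through representatives;
    [ann_scaleE] shows independence of the choice. *)
Definition ann_module (R : pzRingType) (I : ideal R) (X : rmod R)
  (XI : annihilated I X) : Type := X.

HB.instance Definition _ (R : pzRingType) (I : ideal R) (X : rmod R)
  (XI : annihilated I X) := GRing.Zmodule.on (ann_module XI).

Definition ann_scale (R : pzRingType) (I : ideal R) (X : rmod R)
  (XI : annihilated I X) (u : (quotient_ring I)^c) (x : ann_module XI) :
  ann_module XI := ract (x : X) (qrepr (u : quotient_ring I)).

Lemma ann_scaleE (R : pzRingType) (I : ideal R) (X : rmod R)
  (XI : annihilated I X) (a : R) (x : ann_module XI) :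
  ann_scale (qpi I a) x = ract (x : X) a.
Proof.
apply/eqP; rewrite -subr_eq0 -ractBr; apply/eqP/XI.
by apply/qpi_eq; apply: qreprK.
Qed.

Lemma ann_scaleA (R : pzRingType) (I : ideal R) (X : rmod R)
    (XI : annihilated I X) (u v : (quotient_ring I)^c) (x : ann_module XI) :
  ann_scale u (ann_scale v x) = ann_scale (u * v) x.
Proof.
rewrite -(qreprK (u : quotient_ring I)) -(qreprK (v : quotient_ring I)).
set a := qrepr _; set b := qrepr _.
have -> : (qpi I a : (quotient_ring I)^c) * (qpi I b : (quotient_ring I)^c)
    = qpi I (b * a).
  by apply: (esym (rmorphM (@qpi R I) b a)).
by rewrite !ann_scaleE ractA.
Qed.
Lemma ann_scale1 (R : pzRingType) (I : ideal R) (X : rmod R)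
    (XI : annihilated I X) : left_id 1 (@ann_scale R I X XI).
Proof.
move=> x; have -> : (1 : (quotient_ring I)^c) = qpi I 1.
  by apply: (esym (rmorph1 (@qpi R I))).
by rewrite ann_scaleE ract1.
Qed.
Lemma ann_scaleDr (R : pzRingType) (I : ideal R) (X : rmod R)
    (XI : annihilated I X) : right_distributive (@ann_scale R I X XI) +%R.
Proof. by move=> u x y; apply: ractDl. Qed.
Lemma ann_scaleDl (R : pzRingType) (I : ideal R) (X : rmod R)
    (XI : annihilated I X) (x : ann_module XI) :
  {morph (@ann_scale R I X XI)^~ x : u v / u + v}.
Proof.
move=> u v.
rewrite -(qreprK (u : quotient_ring I)) -(qreprK (v : quotient_ring I)).
set a := qrepr _; set b := qrepr _.
have -> : (qpi I a : (quotient_ring I)^c) + (qpi I b : (quotient_ring I)^c)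
    = qpi I (a + b).
  by apply: (esym (raddfD (@qpi R I) a b)).
by rewrite !ann_scaleE; apply: ractDr.
Qed.

HB.instance Definition _ (R : pzRingType) (I : ideal R) (X : rmod R)
    (XI : annihilated I X) :=
  GRing.Zmodule_isLmodule.Build (quotient_ring I)^c (ann_module XI)
    (@ann_scaleA R I X XI) (@ann_scale1 R I X XI) (@ann_scaleDr R I X XI)
    (@ann_scaleDl R I X XI).

Lemma ess_im_restr (R : pzRingType) (I : ideal R) (X : rmod R) :
  @ess_im (Mod (quotient_ring I)) (Mod R) (restr_functor (@qpi R I)) X <->
  annihilated I X.
Proof.
split=> [[Y [f [g [_ fg]]]] x a aI|XI].
  pose f' : {linear restr (@qpi R I) Y -> X} := f.
  pose y : Y := (g : {linear X -> restr (@qpi R I) Y}) x.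
  have fy : f' y = x by apply: linE x fg.
  have ya : ract (y : Y) (qpi I a) = 0.
    have -> : qpi I a = 0.
      by rewrite -(raddf0 (@qpi R I)); apply/qpi_eq; rewrite subr0.
    exact: ract0r.
  rewrite -fy -ractZ -(raddf0 f'); congr (f' _).
  exact: ya.
exists (ann_module XI : rmod (quotient_ring I)).
have idl : linear (id : restr (@qpi R I)
    (ann_module XI : rmod (quotient_ring I)) -> X).
  move=> a x y; congr (_ + _); exact: ann_scaleE.
exists (mk_linear idl); apply: mk_iso => [x y //|y].
by exists y.
Qed.

Lemma annihilated_SeS (S : pzRingType) (e : S) (X : rmod S) :
  annihilated (SeS e) X <-> forall x : X, ract x e = 0.
Proof.
split=> [XI x|Xe x a /asboolP [s ->]].
  by apply: XI; apply/asboolP; exists [:: (1, 1)]; rewrite big_seq1 mul1r mulr1.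
elim: s => [|[b c] s IHs]; first by rewrite big_nil ract0r.
by rewrite big_cons ractDr IHs addr0 /= -!ractA Xe ract0l.
Qed.

Lemma idempotent_exact (S : pzRingType) (e : idempotent_elt S) (X : Mod S) :
  ess_im (i_lower_star (idempotent_functors e)) X <->
  in_ker (j_upper_star (idempotent_functors e)) X.
Proof.
have h1 := @ess_im_restr S (SeS e) X; have h2 := @annihilated_SeS S e X.
by have h3 := in_ker_Hom_eS e X; split=> [/h1 /h2 /h3|/h3 /h2 /h1].
Qed.

(** Closed with [Defined] so that its functors compute to [idempotent_functors e] and
    [induced_by_idempotent] holds by conversion. Full faithfulness of [j_!] is deduced from that of
    [j_*]. *)
Definition idempotent_recollement (S : pzRingType) (e : idempotent_elt S) :
  recollement (Mod (quotient_ring (SeS e))) (Mod S) (Mod (corner e)).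
Proof.
apply: (@Recollement _ _ _ (idempotent_functors e)).
- by split; apply: Mod_abelian.
- by split; [apply: restr_functor_additive | apply: Tens_functor_additive
    | apply: Hom_functor_additive].
- by split; [apply: Hom_functor_additive | apply: Tens_functor_additive
    | apply: Hom_functor_additive].
- by split; [apply: Tens_Hom_adjoint | apply: corner_adjoint].
- by split; [apply: quot_left_adjoint | apply: quot_right_adjoint].
- split; [exact: quot_restr_ff | | exact: corner_ff].
  exact: adjoint_triple_ff (@Tens_Hom_adjoint _ _ (eS_bimod e))
    (corner_adjoint e) (@corner_ff _ e).
- exact: idempotent_exact.
Defined.

(** * Representing modules and Morita equivalence *)

(** Having such a finite family of elements and functionals means that [P] is finitely generated
    projective. *)
Definition dual_basis (R : pzRingType) (P : rmod R)
    (s : seq (P * {linear P -> regular_rmod R})) : Prop :=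
  forall p : P, p = \sum_(b <- s) ract b.1 (b.2 p).

Section RepresentingModule.
Variables (R T : pzRingType) (G : functor (Mod R) (Mod T)).
Variables (F H : functor (Mod T) (Mod R)).
Hypotheses (aG : additive_functor G) (FG : adjoint F G) (GH : adjoint G H).

Let P : rmod R := F (regular_rmod T).

Let Gapp (X Y : rmod R) (f : {linear X -> Y}) (x : (G X : rmod T)) :
  (G Y : rmod T) := (fhom G (f : @mor (Mod R) X Y) : {linear _ -> _}) x.

Let GappD (X Y : rmod R) (f g : {linear X -> Y}) x :
  Gapp (f + g) x = Gapp f x + Gapp g x.
Proof. exact: linE x (aG f g). Qed.

Let GappC (X Y Z : rmod R) (g : {linear Y -> Z}) (f : {linear X -> Y}) x :
  Gapp (lin_comp g f) x = Gapp g (Gapp f x).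
Proof. exact: linE x (fhom_comp G (g : @mor (Mod R) Y Z) f). Qed.

Let Gapp0 (X Y : rmod R) x : Gapp (0 : {linear X -> Y}) x = 0.
Proof. by have := linE x (additive0 (X : Mod R) (Y : Mod R) aG). Qed.

Let Gapp1 (X : rmod R) x : Gapp (lin_id X) x = x.
Proof. exact: linE x (fhom_id G X). Qed.

(** [G X] is [Hom(T, G X)], hence [Hom(F T, X)] by adjunction; the universal element is the value at
    [1] of the unit at [T]. *)
Lemma representing_elt : exists u : (G P : rmod T),
  (forall (X : rmod R) (g : (G X : rmod T)),
     exists h : {linear P -> X}, Gapp h u = g) /\
  (forall (X : rmod R) (h h' : {linear P -> X}),
     Gapp h u = Gapp h' u -> h = h').
Proof.
have [eta [eps [etaN epsN tF tG]]] := adjoint_unit_counit FG.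
exists ((eta (regular_rmod T) : {linear regular_rmod T -> _}) 1).
split=> [X g|X h h' hh'].
  pose k : @mor (Mod T) (regular_rmod T) (G X) := elt_hom g.
  exists (eps X \oc fhom F k).
  have e : fhom G (eps X \oc fhom F k) \oc eta (regular_rmod T) = k.
    by rewrite fhom_comp -comp_assoc etaN comp_assoc tG comp_idl.
  by rewrite -[RHS]ract1; have := linE (M := regular_rmod T) 1 e.
have trans (w : @mor (Mod R) P X) :
    w = eps X \oc fhom F (fhom G w \oc eta (regular_rmod T)).
  by rewrite fhom_comp comp_assoc epsN -comp_assoc tF comp_idr.
rewrite (trans h) (trans h'); congr (_ \oc fhom F _); apply: linear_ext => r.
by rewrite [r]regular_gen !ractZ; congr (ract _ _); apply: hh'.
Qed.

(* The images of the maps R -> P span G P, because a map out of P is determined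
   by its values and G, being a left adjoint, turns this into a statement about
   maps out of G P. *)
Lemma representing_span (y : (G P : rmod T)) :
  exists s : seq (P * (G (regular_rmod R) : rmod T)),
    y = \sum_(b <- s) Gapp (elt_hom b.1) b.2.
Proof.
pose N (y : (G P : rmod T)) :=
  exists s : seq (P * (G (regular_rmod R) : rmod T)),
    y = \sum_(b <- s) Gapp (elt_hom b.1) b.2.
have sN : submodule N.
  split; first by exists [::]; rewrite big_nil.
    by move=> _ _ [s ->] [t ->]; exists (s ++ t); rewrite big_cat.
  move=> a _ [s ->]; exists [seq (b.1, a *: b.2) | b <- s].
  rewrite big_map scaler_sumr; apply: eq_bigr => b _ /=.
  by rewrite /Gapp linearZ.
pose q : @mor (Mod T) (G P) (quo_module (to_submod sN) : rmod T) :=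
  lin_quo (to_submod sN).
have [eta [eps [etaN epsN tG tH]]] := adjoint_unit_counit GH.
have q0 : q = 0.
  have trans (w : @mor (Mod T) (G P) (quo_module (to_submod sN) : rmod T)) :
      w = eps _ \oc fhom G (fhom H w \oc eta P).
    by rewrite fhom_comp comp_assoc epsN -comp_assoc tG comp_idr.
  rewrite (trans q) (trans 0); congr (_ \oc fhom G _); apply: linear_ext => x.
  pose k : @mor (Mod R) (regular_rmod R) P := elt_hom x.
  have e : fhom H q \oc eta P \oc k = fhom H 0 \oc eta P \oc k.
    rewrite -!comp_assoc -!etaN !comp_assoc -!fhom_comp comp0l.
    congr (fhom H _ \oc _); apply: linear_ext => g; apply/lin_quo0/asboolP.
    by exists [:: (x, g)]; rewrite big_seq1.
  have := linE (1 : regular_rmod R) e.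
  rewrite -[X in X = _ -> _]/((fhom H q \oc eta P : {linear _ -> _}) (ract x 1)).
  rewrite -[X in _ = X -> _]/((fhom H 0 \oc eta P : {linear _ -> _}) (ract x 1)).
  by rewrite ract1.
by have /lin_quo0/asboolP := linE y q0.
Qed.

(** By [representing_span], [u] is a sum of terms [Gapp (elt_hom x) g], and each [g] is [Gapp f u]
    for some functional [f] on [P]. The sum [k] of the maps [elt_hom x] after [f] then satisfies
    [Gapp k u = u], so [k] is the identity and the pairs [(x, f)] form a dual basis. *)
Lemma representing_module : exists Q : rmod R,
  (exists s, @dual_basis R Q s) /\
  (forall X : rmod R, in_ker G X <-> forall h : {linear Q -> X}, h = 0).
Proof.
have [u [uS uI]] := representing_elt; exists P; split.
  have [s us] := representing_span u.
  have [s' [k [kE ku]]] : exists (s' : seq (P * {linear P -> regular_rmod R}))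
      (k : {linear P -> P}), (forall p, k p = \sum_(b <- s') ract b.1 (b.2 p))
      /\ Gapp k u = \sum_(b <- s) Gapp (elt_hom b.1) b.2.
    elim: s {us} => [|[x g] s [s' [k [kE ku]]]].
      exists [::], 0; split=> [p|]; first by rewrite big_nil.
      by rewrite big_nil Gapp0.
    have [f fu] := uS _ g.
    exists ((x, f) :: s'), (lin_comp (elt_hom x) f + k); split=> [p|].
      by rewrite big_cons -kE.
    by rewrite big_cons GappD ku GappC fu.
  exists s' => p; rewrite -kE; have -> : k = lin_id P.
    by apply: uI; rewrite Gapp1 ku.
  by [].
move=> X; split=> [/Mod_zero_object GX h|hX].
  by apply: uI; rewrite Gapp0; apply: GX.
apply/Mod_zero_object => g; have [h <-] := uS X g.
by rewrite (hX h) Gapp0.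
Qed.
End RepresentingModule.

(** * Morita equivalence with the endomorphism ring of a progenerator *)

Definition End_ring (R : pzRingType) (Q : rmod R) : Type := {linear Q -> Q}.
HB.instance Definition _ (R : pzRingType) (Q : rmod R) :=
  GRing.Zmodule.on (End_ring Q).

Definition End_mul (R : pzRingType) (Q : rmod R) (f g : End_ring Q) :
  End_ring Q := lin_comp f g.

Lemma End_mulA (R : pzRingType) (Q : rmod R) : associative (@End_mul R Q).
Proof. by move=> f g h; apply: lin_compA. Qed.
Lemma End_mul1l (R : pzRingType) (Q : rmod R) :
  left_id (lin_id Q : End_ring Q) (@End_mul R Q).
Proof. by move=> f; apply: lin_comp_idl. Qed.
Lemma End_mul1r (R : pzRingType) (Q : rmod R) :
  right_id (lin_id Q : End_ring Q) (@End_mul R Q).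
Proof. by move=> f; apply: lin_comp_idr. Qed.
Lemma End_mulDl (R : pzRingType) (Q : rmod R) :
  left_distributive (@End_mul R Q) +%R.
Proof. by move=> f g h; apply: lin_compDl. Qed.
Lemma End_mulDr (R : pzRingType) (Q : rmod R) :
  right_distributive (@End_mul R Q) +%R.
Proof. by move=> f g h; apply: lin_compDr. Qed.

HB.instance Definition _ (R : pzRingType) (Q : rmod R) :=
  GRing.Zmodule_isPzRing.Build (End_ring Q) (@End_mulA R Q) (@End_mul1l R Q)
    (@End_mul1r R Q) (@End_mulDl R Q) (@End_mulDr R Q).

Definition End_bimod (R : pzRingType) (Q : rmod R) : bimodule (End_ring Q) R :=
  @Bimodule (End_ring Q) R Q (fun s => s) (fun _ => erefl)
    (fun _ _ _ => erefl) (fun _ _ _ => erefl).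

Section Progenerator.
Variables (R : pzRingType) (Q : rmod R).
Variables (iota : {linear regular_rmod R -> Q}).
Variables (pi : {linear Q -> regular_rmod R}).
Variables (s : seq (Q * {linear Q -> regular_rmod R})).
Hypotheses (piK : forall r, pi (iota r) = r) (sP : dual_basis s).

Let B := End_bimod Q.

(** The inverse sends [x] to [(x pi(-)) ⊗ iota 1]. On [h ⊗ q] this works because [h(q) pi(-)] is [h]
    after the endomorphism [t = q pi(-)]; moving [t] across the tensor sign gives
    [h ⊗ t (iota 1) = h ⊗ q]. *)
Lemma End_counit_iso (X : rmod R) : @is_iso (Mod R) _ X (tens_counit B X).
Proof.
pose inv (x : X) := tens (P := B) (lin_comp (elt_hom x) pi : Hom B X) (iota 1).
have invB : zmod_morphism inv.
  move=> x y; apply/esym/eqP; rewrite subr_eq; apply/eqP.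
  rewrite /inv -tensDl; congr (tens _ _); apply: linear_ext => q.
  by rewrite -[RHS]/(ract (x - y) (pi q) + ract y (pi q)) -ractDl subrK.
have invK : cancel (tens_counit B X) inv.
  apply: tens_additive_ext => [u v|//|h q].
    by rewrite raddfB invB.
  rewrite tens_counitE /inv.
  pose t : End_ring Q := lin_comp (elt_hom q) pi.
  have -> : (lin_comp (elt_hom ((h : {linear Q -> X}) q)) pi : Hom B X) =
      ract h t.
    apply: linear_ext => p.
    by rewrite -[RHS]/((h : {linear Q -> X}) (ract q (pi p))) ractZ.
  rewrite tens_mid; congr (tens _ _).
  by rewrite -[LHS]/(ract q (pi (iota 1))) piK ract1.
apply: mk_iso => [|x]; first exact: can_inj invK.
exists (inv x); rewrite tens_counitE.
by rewrite -[LHS]/(ract x (pi (iota 1))) piK ract1.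
Qed.

(** A functional [b] and an element [q] give the endomorphism [q b(-)]; acting with it on [y] is
    balanced and so contracts [Y ⊗ Q] back to [Y]. *)
Let trace_in (Y : rmod (End_ring Q)) (b : {linear Q -> regular_rmod R}) (y : Y)
  (q : Q) : Y := ract y (lin_comp (elt_hom q) b : End_ring Q).

Let trace_balanced (Y : rmod (End_ring Q)) b :
  balanced (P := B) (@trace_in Y b).
Proof.
split=> [y y' q|y q q'|y t q]; rewrite /trace_in ?ractDl //.
  rewrite -ractDr; congr (ract _ _); apply: linear_ext => p.
  by rewrite -[LHS]/(ract (q + q') (b p)) ractDl.
rewrite ractA; congr (ract _ _); apply: linear_ext => p.
by rewrite -[LHS]/((t : {linear Q -> Q}) (ract q (b p))) ractZ.
Qed.

(** The dual basis writes the identity of [Q] as the sum of the [b.1 b.2(-)], so [y] is the sum of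
    the contractions of [y ⊗ b.1] and the unit is injective. Since [tr b w ⊗ q = w b(q)], the sum of
    the [tr b.2 (g b.1)] is a preimage of [g]. *)
Lemma End_unit_iso (Y : rmod (End_ring Q)) :
  @is_iso (Mod (End_ring Q)) Y _ (tens_unit B Y).
Proof.
pose tr b := tens_lift (P := B) (@trace_in Y b).
have trE b y q : tr b (tens (P := B) y q) = trace_in b y q.
  by rewrite /tr tens_liftE //; apply: trace_balanced.
have trB b : zmod_morphism (tr b) by apply/tens_liftB/trace_balanced.
apply: mk_iso => [y y' yy'|g].
  have inv (z : Y) : z = \sum_(b <- s) tr b.2 (tens (P := B) z b.1).
    under eq_bigr => b _ do rewrite trE.
    rewrite -[LHS]ract1; have -> : (1 : End_ring Q) =
        \sum_(b <- s) (lin_comp (elt_hom b.1) b.2 : End_ring Q).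
      apply: linear_ext => q; rewrite -[LHS]/q [LHS]sP.
      elim: (s) => [|b s' IHs]; first by rewrite !big_nil.
      by rewrite !big_cons IHs.
    elim: (s) => [|b s' IHs]; first by rewrite !big_nil ract0r.
    by rewrite !big_cons ractDr IHs.
  rewrite (inv y) (inv y'); apply: eq_bigr => b _; congr (tr _ _).
  pose h (z : Y) : {linear Q -> Tens B Y} := tens_unit B Y z.
  have : h y = h y' by [].
  by move/(congr1 (fun k : {linear Q -> Tens B Y} => k b.1)).
pose g' : {linear Q -> Tens B Y} := g.
exists (\sum_(b <- s) tr b.2 (g' b.1)); apply: linear_ext => q.
have trr b w : tens (P := B) (tr b w) q = ract w (b q).
  move: w; apply: tens_additive_ext => [u v|u v|y p].
  - rewrite trB; apply/esym/eqP; rewrite subr_eq; apply/eqP.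
    by rewrite -tensDl subrK.
  - by rewrite /ract scalerBr.
  - by rewrite trE /trace_in tens_mid [RHS]tensZr.
rewrite [in RHS](sP q) [RHS](raddf_sum g').
rewrite -[LHS]/(tens (P := B) (\sum_(b <- s) tr b.2 (g' b.1)) q).
elim: (s) => [|b s' IHs].
  rewrite !big_nil; apply: (addIr (tens (P := B) (0 : Y) q)).
  by rewrite add0r -tensDl addr0.
rewrite !big_cons tensDl IHs trr; congr (_ + _).
exact: esym (ractZ g' _ _).
Qed.

Lemma End_Hom_equivalence : is_equivalence (Hom_functor B).
Proof.
have [uN cN _ _] := Tens_Hom_unit_counit B.
exists (Tens_functor B); split.
  by exists (fun X => tens_counit B X); split; [exact: cN|exact: End_counit_iso].
apply: nat_iso_sym; exists (fun Y => tens_unit B Y).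
by split; [move=> X Y f; rewrite -uN|exact: End_unit_iso].
Qed.
End Progenerator.

Lemma idempotent_of_dual_basis (R : pzRingType) (P : rmod R)
    (s : seq (P * {linear P -> regular_rmod R})) :
  dual_basis s ->
  exists (S : pzRingType) (e : idempotent_elt S)
    (Phi : functor (Mod R) (Mod S)),
    is_equivalence Phi /\
    (forall X : rmod R, in_ker (Hom_functor (eS_bimod e)) (Phi X) <->
       forall h : {linear P -> X}, h = 0).
Proof.
move=> sP; have [i1 [i2 [p1 [p2 []]]]] := Mod_biproduct (regular_rmod R) P.
set Q : rmod R := (_ * _)%type in i1 i2 p1 p2 *.
move=> p1i1 p2i2 p1i2 p2i1 idQ.
pose i1' : {linear regular_rmod R -> Q} := i1.
pose i2' : {linear P -> Q} := i2.
pose p1' : {linear Q -> regular_rmod R} := p1.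
pose p2' : {linear Q -> P} := p2.
(* A dual basis of [Q]: the generator [1] of the summand [R] with its projection, then the given one
   carried over along [i2] and [p2]. *)
pose t : seq (Q * {linear Q -> regular_rmod R}) :=
  (i1' 1, p1') :: [seq (i2' b.1, lin_comp b.2 p2') | b <- s].
have tP : dual_basis t.
  move=> q; rewrite big_cons big_map -[LHS](linE q idQ) /=.
  rewrite -[LHS]/(i1' (p1' q) + i2' (p2' q)); congr (_ + _).
    by rewrite -[RHS]ractZ -regular_gen.
  rewrite [p2' q in LHS]sP raddf_sum; apply: eq_bigr => b _; exact: ractZ.
have ee : (lin_comp i2' p2' : End_ring Q) * (lin_comp i2' p2' : End_ring Q) =
    (lin_comp i2' p2' : End_ring Q).
  rewrite -[LHS]/(lin_comp (lin_comp i2' p2') (lin_comp i2' p2')).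
  rewrite lin_compA -(lin_compA i2' p2' i2').
  by rewrite [lin_comp p2' i2']p2i2 [lin_comp i2' _]lin_comp_idr.
exists (End_ring Q), (Idempotent ee), (Hom_functor (End_bimod Q)); split.
  by apply: (@End_Hom_equivalence R Q i1' p1' t) => // r; apply: linE r p1i1.
(* The idempotent acts on [g] as [g i2 p2]. This is zero if [g i2] is; conversely, for [g = h p2],
   its value at [i2 p] is [h p]. *)
move=> X; rewrite in_ker_Hom_eS; split=> [H h|H g].
  have := H (lin_comp h p2' : Hom (End_bimod Q) X).
  rewrite -[ract _ _]/(lin_comp (lin_comp h p2') (lin_comp i2' p2')) => h0.
  have p2K p : p2' (i2' p) = p by apply: linE p p2i2.
  apply: linear_ext => p; have := linE (i2' p) h0.
  by rewrite -[X in X = _ -> _]/(h (p2' (i2' (p2' (i2' p))))) !p2K.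
rewrite -[LHS]/(lin_comp g (lin_comp i2' p2')) lin_compA.
by rewrite (H (lin_comp g i2')); apply: linear_ext.
Qed.

(** [G = Theta j^*] has the adjoints [j_! Lam] and [j_* Lam] and, [Theta] being faithful, the same
    kernel as [j^*]. Its representing module yields an idempotent for which
    [recollement_equiv_of_ker] applies. *)
Lemma recollement_module_cat_idempotent (A : pzRingType) (B C : preadditive)
    (R : recollement B (Mod A) C) (T : pzRingType) (Theta : functor C (Mod T)) :
  is_equivalence Theta ->
  exists (S : pzRingType) (e : idempotent_elt S),
    morita_equivalent S A /\ recollement_equiv R (idempotent_recollement e).
Proof.
move=> ThetaE; have [Lam [LT TL]] := ThetaE.
have [_ aA aC] := rec_abelian R.
have aTheta := is_equivalence_additive (ab_biproduct aC) (ab_zero aC) ThetaE.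
have [aj _ _] := rec_additive_j R; have [lj jr] := rec_adjoint_j R.
pose G := fcomp Theta (j_upper_star R).
have FG : adjoint (fcomp (j_lower_shriek R) Lam) G.
  exact: adjoint_comp (is_equivalence_adjoint TL LT) lj.
have GH : adjoint G (fcomp (j_lower_star R) Lam).
  exact: adjoint_comp jr (is_equivalence_adjoint LT TL).
have [P [[s sP] kP]] := representing_module (additive_fcomp aTheta aj) FG GH.
have [S [e [Phi [PhiE kPhi]]]] := idempotent_of_dual_basis sP.
exists S, e; split.
  have [Psi [PsiPhi PhiPsi]] := PhiE.
  by exists Psi; apply: is_equivalence_sym PsiPhi PhiPsi.
apply: recollement_equiv_of_ker PhiE _ => X.
apply: iff_trans (iff_trans (kP X) (iff_sym (kPhi X))).
split=> [/zero_objectP z|/zero_objectP z]; apply/zero_objectP.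
  by rewrite -[idm _](fhom_id Theta (j_upper_star R X)) z additive0.
apply: (is_equivalence_faithful LT).
by rewrite fhom_id additive0.
Qed.

(** * Recollements over semiprimary rings *)

(** [j] preserves the kernel [k]. The identity of [j M] is killed by [fhom j p], as [j Q] is zero,
    so it factors through [j K], which is zero. *)
Lemma in_ker_extension (A C : preadditive) (j : functor A C)
    (l : functor C A) (K M Q : A) (k : mor K M) (p : mor M Q) :
  adjoint l j -> additive_functor l -> additive_functor j ->
  is_kernel k p -> in_ker j K -> in_ker j Q -> in_ker j M.
Proof.
move=> lj al aj kp [jK _] [jQ _].
have [_ jkU] := right_adjoint_kernel lj al aj kp.
have [|w [jkw _]] := jkU _ (idm (j M)); first exact: jQ.
by apply/zero_objectP; rewrite -jkw (jK _ w 0) comp0r.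
Qed.

(* The Newton step x -> 3 x^2 - 2 x^3 for the equation x^2 = x,
   with t = x^2 - x. *)
Lemma idempotent_step (A : pzRingType) (x t : A) :
  x * x = x + t -> let y := x + t * (1 - x *+ 2) in
  y * y - y = t * t * (t *+ 4 - 1 *+ 3).
Proof.
move=> xx; have xt : x * t = t * x.
  have -> : t = x * x - x by rewrite xx addrC addKr.
  by rewrite mulrBr mulrBl mulrA.
(* [d] is kept abstract. It commutes with [x] and [t], and [x *+ 2 = 1 - d], so
   [y y - y = t - t d d + t t d d]; with [d d = 1 + 4 t] this becomes [t t (d d - 4)]. *)
have [d dE] : exists d, d = 1 - x *+ 2 by exists (1 - x *+ 2).
have xd : x * d = d * x by rewrite dE mulrBr mulrBl mulr1 mul1r mulrnAr mulrnAl.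
have td : t * d = d * t.
  by rewrite dE mulrBr mulrBl mulr1 mul1r mulrnAr mulrnAl xt.
have dd : d * d = 1 + t *+ 4.
  have XX : x *+ 2 * (x *+ 2) = t *+ 4 + x *+ 2 + x *+ 2.
    have x4 : x *+ 2 + x *+ 2 = x *+ 4 by rewrite -mulrnDr.
    by rewrite mulrnAl mulrnAr -mulrnA xx mulrnDl -[RHS]addrA x4 addrC.
  rewrite dE mulrBr mulr1 mulrBl mul1r opprB XX addrK addrA addrAC addrNK.
  by rewrite addrC.
rewrite -dE /=.
have x2 : x *+ 2 = 1 - d by rewrite dE opprB addrC subrK.
have -> : (x + t * d) * (x + t * d) =
    x + t + t * d * (x *+ 2) + t * t * (d * d).
  have xtd : x * (t * d) = t * d * x by rewrite mulrA xt -!mulrA xd.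
  have tdtd : t * d * (t * d) = t * t * (d * d).
    by rewrite mulrA -(mulrA t d t) -td !mulrA.
  by rewrite mulrDl !mulrDr xx xtd tdtd !addrA.
have e (a b p q w : A) : a + b + (p - q) + w - (a + p) = b - q + w.
  rewrite (addrACA a b p) -(addrA (a + p)) [_ + (_ + w)]addrC.
  by rewrite addrK.
have -> : t * d * (x *+ 2) = t * d - t * (d * d).
  by rewrite x2 mulrBr mulr1 mulrA.
have e' (a b c : A) : a - c = b + a - (c + b).
  by rewrite [b + a]addrC [c + b]addrC addrKA.
have -> : t *+ 4 - 1 *+ 3 = d * d - 1 *+ 4.
  by rewrite dd [1 *+ 4]mulrSr -e'.
rewrite e.
have -> : t - t * (d * d) = - (t * t *+ 4).
  by rewrite -{1}(mulr1 t) -mulrBr dd opprD addNKr mulrN mulrnAr.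
by rewrite mulrBr mulrnAr mulr1 addrC.
Qed.

(** Each Newton step changes [x] by a multiple of the error [t], which lies in both ideals, and
    replaces [t] by a multiple of [t t]. Repeating it brings the nilpotent error to zero. *)
Lemma idempotent_lifting (A : pzRingType) (I J : ideal A) (x : A) :
  nilpotent_ideal J -> x \in ideal_pred I -> x * x - x \in ideal_pred J ->
  exists e : idempotent_elt A,
    (e : A) \in ideal_pred I /\ (e : A) - x \in ideal_pred J.
Proof.
move=> [n nJ] xI tJ.
have [k tk] : exists k, (x * x - x) ^+ (2 ^ k) = 0.
  (* The exponent [2 ^ n] is at least [n], so the power contains a product of [n] elements of
     [J]. *)
  exists n; rewrite -(subnKC (ltnW (ltn_expl n (ltnSn 1)))) exprD.
  have -> : (x * x - x) ^+ n = \prod_(y <- nseq n (x * x - x)) y.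
    by rewrite big_nseq -Monoid.iteropE.
  by rewrite nJ ?mul0r ?size_nseq // all_nseq /= tJ orbT.
elim: k x xI tJ tk => [|k IHk] x xI tJ tk.
  have ee : x * x = x by apply/eqP; rewrite -subr_eq0 -[_ - _]expr1 tk.
  by exists (Idempotent ee); split=> //=; rewrite subrr rpred0.
set t := x * x - x in tJ tk.
have xx : x * x = x + t by rewrite /t addrC subrK.
have tI : t \in ideal_pred I by rewrite rpredB // idealMl.
have stepE := idempotent_step xx.
have [||| e [eI eJ]] := IHk (x + t * (1 - x *+ 2)).
- by rewrite rpredD // idealMr.
- by rewrite stepE -mulrA idealMr.
(* The factors of the new error commute, so its power [2 ^ k] contains [t] to the power [2 ^ k.+1],
   which is zero. *)
- have tu : GRing.comm (t * t) (t *+ 4 - 1 *+ 3).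
    apply: commrB; apply: commrMn; last exact: commr1.
    by rewrite /GRing.comm mulrA.
  by rewrite stepE exprMn_comm // -expr2 -exprM -expnS tk mul0r.
exists e; split=> //.
have -> : (e : A) - x = (e : A) - (x + t * (1 - x *+ 2)) + t * (1 - x *+ 2).
  by rewrite opprD addrA subrK.
by rewrite rpredD // idealMr.
Qed.

(** The image [N] of [I] in the quotient has a complement [N']; decompose [1 = x + z] accordingly.
    For [i] in [I], the class of [i - x i] equals [z i], which lies in both [N] and [N'], so it
    vanishes. *)
Lemma semisimple_lift (A : pzRingType) (I J : ideal A) :
  semisimple_ring (quotient_ring J) ->
  exists2 x, x \in ideal_pred I &
    forall i, i \in ideal_pred I -> i - x * i \in ideal_pred J.
Proof.
pose N (y : regular_rmod (quotient_ring J)) :=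
  exists2 i, i \in ideal_pred I & y = qpi J i.
have Nsub : submodule N.
  split; first by exists 0; rewrite ?rpred0 // raddf0.
    move=> _ _ [i iI ->] [i' i'I ->]; exists (i + i'); first exact: rpredD.
    by rewrite raddfD.
  move=> a _ [i iI ->].
  exists (i * qrepr (a : quotient_ring J)); first exact: idealMr.
  rewrite -[LHS]/(qmul (qpi J i) (a : quotient_ring J)).
  by rewrite -[in LHS](qreprK (a : quotient_ring J)) qmulE.
move=> /(_ N Nsub) [N' [[N'0 N'D N'Z] NN' split1]].
have [_ [z [[x xI ->] N'z one]]] := split1 (qpi J 1).
exists x => // i iI; apply/qpi_eq/eqP; rewrite -subr_eq0; apply/eqP.
apply: NN'.
  by exists (i - x * i); rewrite ?rpredB ?idealMl // raddfB.
have oneE : qpi J 1 = qpi J x + z :> quotient_ring J by exact: one.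
have iE : qpi J i = qpi J (x * i) + qmul z (qpi J i).
  by rewrite -[in RHS]qmulE -qmulDl -oneE qmulE mul1r.
have -> : qpi J i - qpi J (x * i) = qmul z (qpi J i).
  by rewrite {1}iE addrC addKr.
exact: (N'Z (qpi J i)).
Qed.

Lemma semiprimary_idempotent (A : pzRingType) (I : ideal A) :
  semiprimary A -> exists2 e : idempotent_elt A, (e : A) \in ideal_pred I &
    forall i, i \in ideal_pred I -> i - (e : A) * i \in ideal_pred (jacobson A).
Proof.
move=> [nJ ssJ]; have [x xI xP] := semisimple_lift I ssJ.
(* The left identity property [xP], applied to [x] itself, says that [x] is idempotent modulo the
   radical. *)
have xJ : x * x - x \in ideal_pred (jacobson A).
  by rewrite -rpredN opprB xP.
have [e [eI eJ]] := idempotent_lifting nJ xI xJ; exists e => // i iI.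
have -> : i - (e : A) * i = (i - x * i) - ((e : A) - x) * i.
  by rewrite mulrBl opprB addrA subrK.
by rewrite rpredB ?idealMr // xP.
Qed.

(** * The ideal describing the kernel of a recollement *)

Section TorsionIdeal.
Variables (A : pzRingType) (B C : preadditive) (R : recollement B (Mod A) C).

Let j := j_upper_star R.

(** [U = i_* i^* A] and [u] is the unit. An object of the kernel is isomorphic to some [i_* Y], and
    maps into [i_* Y] factor through the unit. *)
Lemma recollement_reflection :
  exists (U : rmod A) (u : {linear regular_rmod A -> U}),
  in_ker j U /\
  forall (X : rmod A) (f : {linear regular_rmod A -> X}), in_ker j X ->
    exists g : {linear U -> X}, forall a, f a = g (u a).
Proof.
have [adj _] := rec_adjoint_i R.
have [eta [eps [etaN epsN tF tG]]] := adjoint_unit_counit adj.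
exists (i_lower_star R (i_upper_star R (regular_rmod A))),
  (eta (regular_rmod A)).
split.
  apply/(rec_exact R); exists (i_upper_star R (regular_rmod A)).
  by exists (idm _); apply: is_iso_idm.
move=> X f /(rec_exact R) [Y [h [h' [_ hh']]]].
pose f' : @mor (Mod A) (regular_rmod A) X := f.
pose k := h \oc fhom (i_lower_star R)
  (eps Y \oc fhom (i_upper_star R) (h' \oc f')).
exists k; move=> a.
have e : f' = k \oc eta (regular_rmod A).
  rewrite /k fhom_comp -!comp_assoc etaN.
  by rewrite (comp_assoc (fhom (i_lower_star R) (eps Y))) tG comp_idl comp_assoc
    hh' comp_idl.
exact: linE a e.
Qed.

(** [I] is the kernel of [u]. If [X] is in the kernel of [j], the map [elt_hom x] factors through
    [u] and so kills [I]. Conversely, [A/I] embeds in [U] and hence is in the kernel of [j], and a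
    module annihilated by [I] is covered by maps from [A/I]. *)
Lemma torsion_ideal : exists I : ideal A,
  forall X : rmod A, in_ker j X <-> annihilated I X.
Proof.
have [U [u [kU uP]]] := recollement_reflection.
have [aj al ar] := rec_additive_j R; have [lj jr] := rec_adjoint_j R.
pose Ip : {pred A} := fun r => u r == 0.
have Iz : zmod_closed Ip.
  split=> [|x y]; rewrite !unfold_in; first exact/eqP/(raddf0 u).
  move=> /eqP ux /eqP uy; apply/eqP.
  apply: etrans (raddfB u _ _) _.
  by rewrite [X in X - _]ux [X in _ - X]uy subr0.
have IMr a x : x \in Ip -> x * a \in Ip.
  rewrite !unfold_in => /eqP ux; apply/eqP.
  by rewrite -[LHS]/(u (ract (x : regular_rmod A) a)) ractZ ux ract0l.
have TI X : in_ker j X -> forall (x : X) a, a \in Ip -> ract x a = 0.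
  move=> kX x a; rewrite unfold_in => /eqP ua.
  have [g gP] := uP X (elt_hom x) kX.
  by rewrite -[LHS]/(elt_hom x a) gP ua raddf0.
(* [u (a x) = (u a) x] vanishes because [U] itself lies in the kernel of [j]. *)
have IMl a x : x \in Ip -> a * x \in Ip.
  move=> xI; rewrite unfold_in; apply/eqP.
  rewrite -[LHS]/(u (ract (a : regular_rmod A) x)) ractZ.
  exact: (TI U).
exists (Ideal Iz IMl IMr) => X; split; first exact: TI.
move=> XI.
pose K := to_submod (ker_submodule u).
pose q := lin_quo K.
have qcok : @is_cokernel (Mod A) _ _ _ q (lin_sub K).
  apply: quo_cokernel => [y|x]; first by have [x ->] := quo_pi_surj y; exists x.
  rewrite lin_quo0; split=> [xK|[y <-]]; last exact: (subP y).
  by exists (SubElt xK).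
have fac (Y : rmod A) (f : {linear regular_rmod A -> Y}) :
    (forall a, u a = 0 -> f a = 0) ->
    exists g : {linear quo_module K -> Y}, forall a, g (q a) = f a.
  move=> fK; have [|g [gq _]] := qcok.2 Y f.
    apply: linear_ext => x; apply: fK.
    exact/asboolP/(subP x).
  by exists g => a; apply: linE a gq.
have [ubar ubarP] := fac U u (fun _ => id).
have kQ : in_ker j (quo_module K : rmod A).
  have mj : mono (fhom j (ubar : @mor (Mod A) (quo_module K : rmod A) U)).
    apply: right_adjoint_mono lj _ => W g h gh; apply: linear_ext => w.
    have := linE w gh.
    rewrite -[X in X = _ -> _]/(ubar ((g : {linear _ -> quo_module K}) w)).
    rewrite -[X in _ = X -> _]/(ubar ((h : {linear _ -> quo_module K}) w)).
    set y := (g : {linear _ -> quo_module K}) w.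
    set z := (h : {linear _ -> quo_module K}) w.
    have [a ya] := quo_pi_surj y; have [b zb] := quo_pi_surj z.
    rewrite ya zb => /eqP; rewrite -subr_eq0 -raddfB => /eqP uab.
    apply/quo_pi_eq/asboolP.
    by rewrite -[LHS]ubarP -[RHS]uab; congr (ubar _); apply: raddfB.
  apply/zero_objectP; apply: mj; have [+ _] := kU; exact.
have [eta [eps [etaN epsN tF tG]]] := adjoint_unit_counit jr.
apply/zero_objectP.
have trans (w : mor (j X) (j X)) :
    w = eps _ \oc fhom j (fhom (j_lower_star R) w \oc eta X).
  by rewrite fhom_comp comp_assoc epsN -comp_assoc tF comp_idr.
(* The identity and zero of [j X] are compared through their transposes, maps from [X] to
   [j_* j^* X], element by element. Each [x] is the image of the class of [1] under some [g] from
   [A/I], and after [g] both transposes factor through [j] of [A/I], a zero object. *)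
rewrite (trans (idm _)) (trans 0); congr (_ \oc fhom j _).
apply: linear_ext => x.
have [g gP] : exists g : {linear quo_module K -> X},
    forall a, g (q a) = elt_hom x a.
  by apply: fac => a ua; apply: XI; rewrite unfold_in; apply/eqP.
pose g' : @mor (Mod A) (quo_module K : rmod A) X := g.
have e : fhom (j_lower_star R) (idm (j X)) \oc eta X \oc g' =
    fhom (j_lower_star R) 0 \oc eta X \oc g'.
  rewrite -!comp_assoc -etaN !comp_assoc -!fhom_comp.
  by congr (fhom _ _ \oc _); have [_ +] := kQ; apply.
have xE : g (q 1) = x by rewrite gP; apply: ract1.
by rewrite -xE; apply: linE (q 1) e.
Qed.

(** Induction on [n]: the elements killed by [I] form a submodule [N] in the kernel of [j], products
    of one factor fewer kill [X/N], and the kernel is closed under extensions. *)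
Lemma torsion_power (I : ideal A) (n : nat) (X : rmod A) :
  (forall X : rmod A, in_ker j X <-> annihilated I X) ->
  (forall (x : X) (s : seq A), size s = n -> all (mem I) s ->
     ract x (\prod_(a <- s) a) = 0) ->
  in_ker j X.
Proof.
move=> kI; have [aj al ar] := rec_additive_j R; have [lj jr] := rec_adjoint_j R.
elim: n X => [|n IHn] X Xn.
  (* For [n = 0] the empty product is [1], so [X] is zero. *)
  by apply/kI => x a _; have := Xn x [::] erefl erefl; rewrite big_nil ract1
    => ->; rewrite ract0l.
pose N (x : X) := forall a, a \in ideal_pred I -> ract x a = 0.
have sN : submodule N.
  split=> [a _|x y xN yN a aI|b x xN a aI]; first exact: ract0l.
    by rewrite ractDl xN // yN // addr0.
  by rewrite -[b *: x]/(ract x (b : A)) ractA xN // idealMl.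
pose q := lin_quo (to_submod sN); pose k := lin_sub (to_submod sN).
have kq : @is_kernel (Mod A) _ _ _ k q.
  apply: sub_kernel => [|x]; first exact: val_inj.
  rewrite lin_quo0; split=> [xN|[y <-]]; last exact: (subP y).
  by exists (SubElt xN).
apply: in_ker_extension lj al aj kq _ _.
  apply/kI => x a aI; apply: val_inj.
  rewrite -[LHS]/(k (ract x a)) ractZ -[RHS](raddf0 k) (raddf0 k).
  by have /asboolP := subP x; apply.
apply: IHn => y s sz sI; have [x ->] := quo_pi_surj y.
rewrite -[LHS]ractZ; apply/lin_quo0/asboolP => a aI.
rewrite ractA.
have -> : (\prod_(b <- s) b) * a = \prod_(b <- rcons s a) b.
  by rewrite -cats1 big_cat big_seq1.
by apply: Xn; rewrite ?size_rcons ?sz // all_rcons /= aI.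
Qed.
End TorsionIdeal.

Lemma semiprimary_recollement (A : pzRingType) (B C : preadditive)
    (R : recollement B (Mod A) C) :
  semiprimary A ->
  exists e : idempotent_elt A, recollement_equiv R (idempotent_recollement e).
Proof.
move=> spA; have [I kI] := torsion_ideal R.
have [e eI eP] := semiprimary_idempotent I spA; have [[n nJ] _] := spA.
exists e; apply: recollement_equiv_of_ker (fid_is_equivalence _) _ => X.
apply: iff_trans _ (iff_sym (in_ker_Hom_eS e X)).
split=> [/kI XI x|Xe]; first exact: XI.
apply: (torsion_power (n := n) kI) => x s sz sI.
(* As every element of [X] is killed by [e], each factor [a] acts like [a - e a], which lies in the
   radical; a product of [n] such factors vanishes. *)
have -> : ract x (\prod_(a <- s) a) =
    ract x (\prod_(a <- [seq a - (e : A) * a | a <- s]) a).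
  elim: s x {sz sI} => [x|a s IHs x]; first by rewrite !big_nil.
  rewrite big_cons [in RHS]big_cons -!ractA IHs; congr (ract _ _).
  by rewrite ractBr -[X in _ = _ - X]ractA Xe ract0l subr0.
rewrite nJ ?ract0r ?size_map // all_map; apply: sub_all sI => a aI.
exact: eP.
Qed.

Theorem mainTheorem1 (A : pzRingType) :
  (forall (B C : preadditive) (R : recollement B (Mod A) C),
     (exists (B' A' C' : pzRingType)
             (R' : recollement (Mod B') (Mod A') (Mod C')),
        recollement_equiv R R')
     <->
     (exists (S : pzRingType) (e : idempotent_elt S)
             (R' : recollement (Mod (quotient_ring (SeS e))) (Mod S)
                               (Mod (corner e))),
        [/\ morita_equivalent S A, induced_by_idempotent R'
          & recollement_equiv R R'])) /\
  (semiprimary A ->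
   forall (B C : preadditive) (R : recollement B (Mod A) C),
     exists (e : idempotent_elt A)
            (R' : recollement (Mod (quotient_ring (SeS e))) (Mod A)
                              (Mod (corner e))),
       induced_by_idempotent R' /\ recollement_equiv R R').
Proof.
split=> [B C R|spA B C R].
  split=> [[_ [_ [C' [_ [_ [Theta [_ ThetaE _]]]]]]]|[S [e [R' [_ _ RR']]]]].
    have [S [e [SA RS]]] := recollement_module_cat_idempotent R ThetaE.
    by exists S, e, (idempotent_recollement e).
  by exists (quotient_ring (SeS e)), S, (corner e), R'.
have [e Re] := semiprimary_recollement R spA.
by exists e, (idempotent_recollement e).
Qed.
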